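(* Let $F$ be a field and let $L(\Gamma_1)$ be the Leavitt path algebra over $F$ of the graph $\Gamma_1$ with two vertices $v_1,v_2$ and two edges: a loop $c$ at $v_1$ and an edge $e$ from $v_1$ to $v_2$. Then $$\mathrm{Aut}(L(\Gamma_1))\cong F^*\ltimes GL_\infty(F),$$ a semidirect product of the multiplicative group $F^*$ of the field $F$ with the finitary general linear group $GL_\infty(F)$ (the latter being the normal factor). If $F^2=F$ (every element of $F$ is a square in $F$), then the only involution on $L(\Gamma_1)$, up to isomorphism, is the standard involution $*$; that is, for every involution $\bar{\ }$ on $L(\Gamma_1)$ the involutive algebras $(L(\Gamma_1),\bar{\ })$ and $(L(\Gamma_1),* )$ are isomorphic.
   Context: The Leavitt path algebra $L(\Gamma)$ over $F$ of a finite directed graph $\Gamma=(V,E)$ with source and range maps $s,r:E\to V$ is the associative $F$-algebra presented by generators $\{v : v\in V\}\cup\{e,e^* : e\in E\}$ and relations: (i) $v_iv_j=\delta_{v_i,v_j}v_i$ for all $v_i,v_j\in V$; (ii) $s(e)e=e\,r(e)=e$ and $r(e)e^*=e^*s(e)=e^*$ for all $e\in E$; (iii) $e^*f=\delta_{e,f}\,r(e)$ for all $e,f\in E$; (iv) $v=\sum_{s(e)=v}ee^*$ for every vertex $v$ with $s^{-1}(v)\neq\emptyset$. $\mathrm{Aut}(L(\Gamma_1))$ is the group of $F$-algebra automorphisms. $GL_\infty(F)$ is the group of invertible matrices in $\mathrm{Id}+M_\infty(F)$, where $M_\infty(F)$ is the algebra of infinite $\mathbb{N}\times\mathbb{N}$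 matrices over $F$ with only finitely many nonzero entries and $\mathrm{Id}$ is the infinite identity matrix; equivalently $GL_\infty(F)=\bigcup_{n\ge1}GL_n(F)$. An involution on an $F$-algebra is an $F$-linear anti-automorphism whose square is the identity. The standard involution $*$ on $L(\Gamma)$ is the involution determined by $v\mapsto v$ ($v\in V$), $e\mapsto e^*$, $e^*\mapsto e$ ($e\in E$). Two involutive algebras $(R_1,*_1)$ and $(R_2,*_2)$ are isomorphic if there is an $F$-algebra isomorphism $\varphi:R_1\to R_2$ with $\varphi(a^{*_1})=\varphi(a)^{*_2}$ for all $a\in R_1$. *)

(* Defs.v *)
From HB Require Import structures.
From mathcomp Require Import all_boot all_order all_algebra.
From mathcomp Require Import generic_quotient.
From mathcomp Require Import all_classical.
Set Implicit Arguments.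
Unset Strict Implicit.
Unset Printing Implicit Defensive.
Import GRing.Theory.
Local Open Scope quotient_scope.
Local Open Scope classical_set_scope.
Local Open Scope ring_scope.

(* A quiver has at least one vertex: the empty one would give the zero algebra,
   whereas an algType is nontrivial. *)
Record quiver := Quiver {
  vertex : finType;
  edge : finType;
  src : edge -> vertex;
  tgt : edge -> vertex;
  vertex_gt0 : (0 < #|vertex|)%N }.

Section LeavittPathAlgebra.
Variables (F : fieldType) (G : quiver).

Inductive lterm :=
  | Vert of vertex G
  | Edge of edge G
  | Ghost of edge G
  | Zero
  | Add of lterm & lterm
  | Scale of F & lterm
  | Mul of lterm & lterm.

(* The least congruence containing the axioms of (not necessarily unital)
   associative F-algebras and the relations (i)-(iv) of a Leavitt path algebra;
   the opposite of t is Scale (-1) t. *)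
Inductive lcong : lterm -> lterm -> Prop :=
  | lc_refl t : lcong t t
  | lc_sym t u : lcong t u -> lcong u t
  | lc_trans t u w : lcong t u -> lcong u w -> lcong t w
  | lc_add t t' u u' : lcong t t' -> lcong u u' -> lcong (Add t u) (Add t' u')
  | lc_scale a t t' : lcong t t' -> lcong (Scale a t) (Scale a t')
  | lc_mul t t' u u' : lcong t t' -> lcong u u' -> lcong (Mul t u) (Mul t' u')
  | lc_addA t u w : lcong (Add t (Add u w)) (Add (Add t u) w)
  | lc_addC t u : lcong (Add t u) (Add u t)
  | lc_add0 t : lcong (Add Zero t) t
  | lc_addN t : lcong (Add (Scale (-1) t) t) Zero
  | lc_scaleA a b t : lcong (Scale a (Scale b t)) (Scale (a * b) t)
  | lc_scale1 t : lcong (Scale 1 t) t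
  | lc_scaleDr a t u : lcong (Scale a (Add t u)) (Add (Scale a t) (Scale a u))
  | lc_scaleDl a b t : lcong (Scale (a + b) t) (Add (Scale a t) (Scale b t))
  | lc_mulA t u w : lcong (Mul t (Mul u w)) (Mul (Mul t u) w)
  | lc_mulDl t u w : lcong (Mul (Add t u) w) (Add (Mul t w) (Mul u w))
  | lc_mulDr t u w : lcong (Mul t (Add u w)) (Add (Mul t u) (Mul t w))
  | lc_scaleAl a t u : lcong (Scale a (Mul t u)) (Mul (Scale a t) u)
  | lc_scaleAr a t u : lcong (Scale a (Mul t u)) (Mul t (Scale a u))
  | lc_vert v w : lcong (Mul (Vert v) (Vert w)) (if v == w then Vert v else Zero)
  | lc_srcE e : lcong (Mul (Vert (src e)) (Edge e)) (Edge e)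
  | lc_tgtE e : lcong (Mul (Edge e) (Vert (tgt e))) (Edge e)
  | lc_tgtG e : lcong (Mul (Vert (tgt e)) (Ghost e)) (Ghost e)
  | lc_srcG e : lcong (Mul (Ghost e) (Vert (src e))) (Ghost e)
  | lc_ck1 e f : lcong (Mul (Ghost e) (Edge f))
                       (if e == f then Vert (tgt e) else Zero)
  | lc_ck2 v : (exists e, src e = v) ->
      lcong (Vert v)
            (\big[Add/Zero]_(e : edge G | src e == v) Mul (Edge e) (Ghost e)).

HB.instance Definition _ := gen_eqMixin lterm.
HB.instance Definition _ := gen_choiceMixin lterm.

Definition lcongb (t u : lterm) : bool := `[< lcong t u >].

Lemma lcongb_refl : reflexive lcongb.
Proof. by move=> t; apply/asboolP/lc_refl. Qed.
Lemma lcongb_sym : symmetric lcongb.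
Proof. by move=> t u; apply/asboolP/asboolP; apply: lc_sym. Qed.
Lemma lcongb_trans : transitive lcongb.
Proof.
by move=> t u w /asboolP tu /asboolP uw; apply/asboolP; apply: lc_trans tu uw.
Qed.

Canonical lcong_equiv := EquivRel lcongb lcongb_refl lcongb_sym lcongb_trans.

Definition lpa := {eq_quot lcong_equiv}.
HB.instance Definition _ := Choice.on lpa.
HB.instance Definition _ := Quotient.on lpa.
HB.instance Definition _ := EqQuotient.on lpa.

Definition lcls (t : lterm) : lpa := \pi_lpa t.

Lemma lclsP t u : lcls t = lcls u <-> lcong t u.
Proof.
split=> [/eqP|tu]; first by rewrite /lcls eqmodE => /asboolP.
by apply/eqP; rewrite /lcls eqmodE; apply/asboolP.
Qed.

Lemma lcls_repr (x : lpa) : lcls (repr x) = x.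
Proof. exact: reprK. Qed.

Lemma repr_lcls t : lcong (repr (lcls t)) t.
Proof. by apply/lclsP; rewrite lcls_repr. Qed.

Lemma lpaW (P : lpa -> Prop) : (forall t, P (lcls t)) -> forall x, P x.
Proof. by move=> PP x; rewrite -(lcls_repr x). Qed.

Definition lpa_zero : lpa := lcls Zero.
Definition lpa_add (x y : lpa) : lpa := lcls (Add (repr x) (repr y)).
Definition lpa_scale (a : F) (x : lpa) : lpa := lcls (Scale a (repr x)).
Definition lpa_opp (x : lpa) : lpa := lpa_scale (-1) x.
Definition lpa_mul (x y : lpa) : lpa := lcls (Mul (repr x) (repr y)).
Definition lpa_one : lpa := lcls (\big[Add/Zero]_(v : vertex G) Vert v).

Lemma lcls_add t u : lpa_add (lcls t) (lcls u) = lcls (Add t u).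
Proof. by apply/lclsP/lc_add; apply: repr_lcls. Qed.
Lemma lcls_scale a t : lpa_scale a (lcls t) = lcls (Scale a t).
Proof. by apply/lclsP/lc_scale; apply: repr_lcls. Qed.
Lemma lcls_mul t u : lpa_mul (lcls t) (lcls u) = lcls (Mul t u).
Proof. by apply/lclsP/lc_mul; apply: repr_lcls. Qed.
Definition lclsE := (lcls_add, lcls_scale, lcls_mul).

Lemma lpa_addA : associative lpa_add.
Proof.
by elim/lpaW=> t; elim/lpaW=> u; elim/lpaW=> w; rewrite !lclsE;
  apply/lclsP/lc_addA.
Qed.
Lemma lpa_addC : commutative lpa_add.
Proof. by elim/lpaW=> t; elim/lpaW=> u; rewrite !lclsE; apply/lclsP/lc_addC. Qed.
Lemma lpa_add0 : left_id lpa_zero lpa_add.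
Proof. by elim/lpaW=> t; rewrite !lclsE; apply/lclsP/lc_add0. Qed.
Lemma lpa_addN : left_inverse lpa_zero lpa_opp lpa_add.
Proof. by elim/lpaW=> t; rewrite /lpa_opp !lclsE; apply/lclsP/lc_addN. Qed.

HB.instance Definition _ :=
  GRing.isZmodule.Build lpa lpa_addA lpa_addC lpa_add0 lpa_addN.

Lemma lpa_scaleA a b x : lpa_scale a (lpa_scale b x) = lpa_scale (a * b) x.
Proof. by elim/lpaW: x => t; rewrite !lclsE; apply/lclsP/lc_scaleA. Qed.
Lemma lpa_scale1 : left_id 1 lpa_scale.
Proof. by elim/lpaW=> t; rewrite !lclsE; apply/lclsP/lc_scale1. Qed.
Lemma lpa_scaleDr : right_distributive lpa_scale +%R.
Proof.
by move=> a; elim/lpaW=> t; elim/lpaW=> u; rewrite /GRing.add /= !lclsE;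
  apply/lclsP/lc_scaleDr.
Qed.
Lemma lpa_scaleDl x : {morph lpa_scale^~ x : a b / a + b}.
Proof.
by elim/lpaW: x => t a b; rewrite [RHS]/GRing.add /= !lclsE;
  apply/lclsP/lc_scaleDl.
Qed.

HB.instance Definition _ := GRing.Zmodule_isLmodule.Build F lpa
  lpa_scaleA lpa_scale1 lpa_scaleDr lpa_scaleDl.

Lemma lcls0 : lcls Zero = 0. Proof. by []. Qed.
Lemma lclsD t u : lcls (Add t u) = lcls t + lcls u.
Proof. by rewrite -lcls_add. Qed.
Lemma lclsZ a t : lcls (Scale a t) = a *: lcls t.
Proof. by rewrite -lcls_scale. Qed.

Lemma lcls_sum (I : Type) (r : seq I) (P : pred I) (f : I -> lterm) :
  lcls (\big[Add/Zero]_(i <- r | P i) f i) = \sum_(i <- r | P i) lcls (f i).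
Proof. exact: (big_morph lcls lclsD lcls0). Qed.

Lemma lpa_mulA : associative lpa_mul.
Proof.
by elim/lpaW=> t; elim/lpaW=> u; elim/lpaW=> w; rewrite !lclsE;
  apply/lclsP/lc_mulA.
Qed.
Lemma lpa_mulDl : left_distributive lpa_mul +%R.
Proof.
by elim/lpaW=> t; elim/lpaW=> u; elim/lpaW=> w;
  rewrite /GRing.add /= !lclsE; apply/lclsP/lc_mulDl.
Qed.
Lemma lpa_mulDr : right_distributive lpa_mul +%R.
Proof.
by elim/lpaW=> t; elim/lpaW=> u; elim/lpaW=> w;
  rewrite /GRing.add /= !lclsE; apply/lclsP/lc_mulDr.
Qed.
Lemma lpa_scaleAl (a : F) (x y : lpa) : a *: lpa_mul x y = lpa_mul (a *: x) y.
Proof.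
by elim/lpaW: x => t; elim/lpaW: y => u; rewrite lclsE -!lclsZ lclsE;
  apply/lclsP/lc_scaleAl.
Qed.
Lemma lpa_scaleAr (a : F) (x y : lpa) : a *: lpa_mul x y = lpa_mul x (a *: y).
Proof.
by elim/lpaW: x => t; elim/lpaW: y => u; rewrite lclsE -!lclsZ lclsE;
  apply/lclsP/lc_scaleAr.
Qed.

Lemma lpa_mul0l x : lpa_mul 0 x = 0.
Proof. by rewrite -(scale0r 0) -lpa_scaleAl !scale0r. Qed.
Lemma lpa_mul0r x : lpa_mul x 0 = 0.
Proof. by rewrite -(scale0r 0) -lpa_scaleAr !scale0r. Qed.

Lemma lpa_mul_suml (I : Type) (r : seq I) (f : I -> lpa) x :
  lpa_mul (\sum_(i <- r) f i) x = \sum_(i <- r) lpa_mul (f i) x.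
Proof. exact: (big_morph (lpa_mul^~ x) (fun a b => lpa_mulDl a b x) (lpa_mul0l x)).
Qed.
Lemma lpa_mul_sumr (I : Type) (r : seq I) (f : I -> lpa) x :
  lpa_mul x (\sum_(i <- r) f i) = \sum_(i <- r) lpa_mul x (f i).
Proof. exact: (big_morph (lpa_mul x) (lpa_mulDr x) (lpa_mul0r x)). Qed.

Lemma lcls_vert v w :
  lpa_mul (lcls (Vert v)) (lcls (Vert w)) = if v == w then lcls (Vert v) else 0.
Proof.
by rewrite lclsE; case: ifP (lc_vert v w) => _ /lclsP.
Qed.

Lemma lpa_mul1l : left_id lpa_one lpa_mul.
Proof.
have one_vert v : lpa_mul lpa_one (lcls (Vert v)) = lcls (Vert v).
  rewrite /lpa_one lcls_sum lpa_mul_suml (bigD1 v) //= lcls_vert eqxx.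
  by rewrite big1 ?addr0 // => w /negPf; rewrite lcls_vert => ->.
have one_l x v : lpa_mul (lcls (Vert v)) x = x -> lpa_mul lpa_one x = x.
  by move=> vx; rewrite -[in LHS]vx lpa_mulA one_vert vx.
elim/lpaW; elim=> [v|e|e||t IHt u IHu|a t IH|t IHt u IHu].
- exact: one_vert.
- by apply: (one_l _ (src e)); rewrite lclsE; apply/lclsP/lc_srcE.
- by apply: (one_l _ (tgt e)); rewrite lclsE; apply/lclsP/lc_tgtG.
- exact: lpa_mul0r.
- by rewrite lclsD lpa_mulDr IHt IHu.
- by rewrite lclsZ -lpa_scaleAr IH.
- by rewrite -lcls_mul lpa_mulA IHt.
Qed.

Lemma lpa_mul1r : right_id lpa_one lpa_mul.
Proof.
have one_vert v : lpa_mul (lcls (Vert v)) lpa_one = lcls (Vert v).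
  rewrite /lpa_one lcls_sum lpa_mul_sumr (bigD1 v) //= lcls_vert eqxx.
  by rewrite big1 ?addr0 // => w; rewrite lcls_vert eq_sym => /negPf ->.
have one_r x v : lpa_mul x (lcls (Vert v)) = x -> lpa_mul x lpa_one = x.
  by move=> xv; rewrite -[in LHS]xv -lpa_mulA one_vert xv.
elim/lpaW; elim=> [v|e|e||t IHt u IHu|a t IH|t IHt u IHu].
- exact: one_vert.
- by apply: (one_r _ (tgt e)); rewrite lclsE; apply/lclsP/lc_tgtE.
- by apply: (one_r _ (src e)); rewrite lclsE; apply/lclsP/lc_srcG.
- exact: lpa_mul0l.
- by rewrite lclsD lpa_mulDl IHt IHu.
- by rewrite lclsZ -lpa_scaleAl IH.
- by rewrite -lcls_mul -lpa_mulA IHu.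
Qed.

(* Nontriviality: L(G) acts on the functions vertex * nat -> F, the copies of
   nat at a vertex v being split among the edges leaving v by residues modulo
   their number. *)
Section Nontrivial.
Let out (v : vertex G) : seq (edge G) := [seq e <- enum (edge G) | src e == v].
Let deg v := size (out v).
Let idx e := index e (out (src e)).
Let X := (vertex G -> nat -> F)%type.

Let out_mem e : e \in out (src e).
Proof. by rewrite mem_filter eqxx mem_enum. Qed.
Let idx_lt e : (idx e < deg (src e))%N.
Proof. by rewrite index_mem out_mem. Qed.

Fixpoint lact (t : lterm) (x : X) : X :=
  match t with
  | Vert v => fun u n => if u == v then x u n else 0
  | Edge e => fun u n =>
      if (u == src e) && (n %% deg u == idx e)%N then x (tgt e) (n %/ deg u)%N
      else 0
  | Ghost e => fun u n =>
      if u == tgt e then x (src e) (n * deg (src e) + idx e)%N else 0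
  | Zero => fun _ _ => 0
  | Add t u => fun v n => lact t x v n + lact u x v n
  | Scale a t => fun v n => a * lact t x v n
  | Mul t u => lact t (lact u x)
  end.

Let ext2 (x y : X) : (forall u n, x u n = y u n) -> x = y.
Proof. by move=> xy; apply/funext => u; apply/funext => n. Qed.

Let lactD t x y :
  lact t (fun u n => x u n + y u n) = fun u n => lact t x u n + lact t y u n.
Proof.
elim: t x y => [v|e|e||t IHt s IHs|a t IH|t IHt s IHs] x y; apply: ext2 => u n /=.
- by case: ifP; rewrite ?addr0.
- by case: ifP; rewrite ?addr0.
- by case: ifP; rewrite ?addr0.
- by rewrite addr0.
- by rewrite IHt IHs addrACA.
- by rewrite IH mulrDr.
- by rewrite IHs IHt.
Qed.

Let lactZ t a x : lact t (fun u n => a * x u n) = fun u n => a * lact t x u n.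
Proof.
elim: t x => [v|e|e||t IHt s IHs|b t IH|t IHt s IHs] x; apply: ext2 => u n /=.
- by case: ifP; rewrite ?mulr0.
- by case: ifP; rewrite ?mulr0.
- by case: ifP; rewrite ?mulr0.
- by rewrite mulr0.
- by rewrite IHt IHs mulrDr.
- by rewrite IH mulrCA.
- by rewrite IHs IHt.
Qed.

Let lact_sum (I : Type) (r : seq I) (P : pred I) (f : I -> lterm) x u n :
  lact (\big[Add/Zero]_(i <- r | P i) f i) x u n
  = \sum_(i <- r | P i) lact (f i) x u n.
Proof. by apply: (big_morph (fun t => lact t x u n)). Qed.

Let idx_inj e f : src e = src f -> idx e = idx f -> e = f.
Proof.
move=> es ei; rewrite -(nth_index e (out_mem e)) -(nth_index e (out_mem f)).
by rewrite -/(idx e) -/(idx f) ei es.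
Qed.

Lemma lact_sound t u : lcong t u -> lact t = lact u.
Proof.
move=> tu; apply/funext => x; apply: ext2 => w n.
elim: {t u}tu x w n => //=.
- by move=> t u w _ IH1 _ IH2 x v n; rewrite IH1 IH2.
- by move=> t t' u u' _ IH1 _ IH2 x v n; rewrite IH1 IH2.
- by move=> a t t' _ IH x v n; rewrite IH.
- move=> t t' u u' _ IH1 _ IH2 x v n; rewrite IH1.
  by congr (lact t' _ v n); apply: ext2.
- by move=> *; rewrite addrA.
- by move=> *; rewrite addrC.
- by move=> *; rewrite add0r.
- by move=> *; rewrite mulN1r addNr.
- by move=> *; rewrite mulrA.
- by move=> *; rewrite mul1r.
- by move=> *; rewrite mulrDr.
- by move=> *; rewrite mulrDl.
- by move=> t u w x v n; rewrite lactD.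
- by move=> a t u x v n; rewrite lactZ.
- move=> v w x u n; have [->|vw] := eqVneq v w; first by rewrite /=; case: eqP.
  by have [->|//] := eqVneq u v; rewrite (negPf vw).
- by move=> e x u n; case: eqP.
- by move=> e x u n; rewrite eqxx.
- by move=> e x u n; case: eqP.
- by move=> e x u n; rewrite eqxx.
- move=> e f x u n.
  have dgt : (0 < deg (src e))%N by apply: leq_ltn_trans (idx_lt e).
  rewrite modnMDl divnMDl // modn_small ?idx_lt // divn_small ?idx_lt // addn0.
  case: (e =P f) => [->|ef] /=; first by rewrite !eqxx; case: eqP => // ->.
  case: ifP => // _; case: ifP => // /andP[/eqP es /eqP ei].
  by case: ef; apply: idx_inj.
- move=> v [e0 e0v] x u n; rewrite lact_sum /=.
  have [->{u}|uv] := eqVneq u v; last first.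
    rewrite big1 // => e /eqP ev; rewrite ev.
    by rewrite (negPf uv).
  have dgt : (0 < deg v)%N by rewrite -e0v; apply: leq_ltn_trans (idx_lt e0).
  pose e := nth e0 (out v) (n %% deg v).
  have eout : e \in out v by apply: mem_nth; rewrite ltn_pmod.
  have ev : src e = v by move: eout; rewrite mem_filter => /andP[/eqP].
  have ie : idx e = (n %% deg v)%N.
    rewrite /idx ev index_uniq ?ltn_pmod //.
    by rewrite filter_uniq ?enum_uniq.
  rewrite (bigD1 e) /=; last by rewrite ev.
  rewrite ev ie !eqxx /= -divn_eq big1 ?addr0 // => f /andP[/eqP fv fe].
  rewrite fv eqxx /=; case: eqP => // nf; case/eqP: fe.
  by apply: idx_inj; rewrite ?fv ?ev // -nf ie.
Qed.

Lemma lpa_one_neq0 : lpa_one != 0.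
Proof.
apply/negP => /eqP/lclsP/lact_sound E.
have /card_gt0P[v _] := vertex_gt0 G.
have := congr1 (fun f => f (fun _ _ => 1) v 0%N) E.
rewrite lact_sum /= (bigD1 v) //= eqxx big1 ?addr0; last first.
  by move=> w wv; rewrite eq_sym (negPf wv).
by move/eqP; rewrite oner_eq0.
Qed.
End Nontrivial.

HB.instance Definition _ := GRing.Zmodule_isNzRing.Build lpa
  lpa_mulA lpa_mul1l lpa_mul1r lpa_mulDl lpa_mulDr lpa_one_neq0.
HB.instance Definition _ := GRing.Lmodule_isLalgebra.Build F lpa lpa_scaleAl.
HB.instance Definition _ := GRing.Lalgebra_isAlgebra.Build F lpa lpa_scaleAr.

Lemma lclsM t u : lcls (Mul t u) = lcls t * lcls u.
Proof. by rewrite -lcls_mul. Qed.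

Fixpoint lterm_star (t : lterm) : lterm :=
  match t with
  | Vert v => Vert v
  | Edge e => Ghost e
  | Ghost e => Edge e
  | Zero => Zero
  | Add t u => Add (lterm_star t) (lterm_star u)
  | Scale a t => Scale a (lterm_star t)
  | Mul t u => Mul (lterm_star u) (lterm_star t)
  end.

Lemma lterm_starK : involutive lterm_star.
Proof. by elim=> //= [t -> u ->|a t ->|t -> u ->]. Qed.

Lemma lterm_star_cong t u : lcong t u -> lcong (lterm_star t) (lterm_star u).
Proof.
elim=> {t u} /=; try by constructor.
- by move=> t u w _ tu _ uw; apply: lc_trans tu uw.
- by move=> t u w; apply/lc_sym/lc_mulA.
- move=> v w; rewrite [v == w]eq_sym; case: eqP (lc_vert w v) => [->|_] //=.
- move=> e f; rewrite [e == f]eq_sym; case: eqP (lc_ck1 f e) => [->|_] //=.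
- move=> v /lc_ck2 h; rewrite (big_morph lterm_star (id1 := Zero) (op1 := Add)) //.
Qed.

Definition lpa_star (x : lpa) : lpa := lcls (lterm_star (repr x)).

Lemma lcls_star t : lpa_star (lcls t) = lcls (lterm_star t).
Proof. by apply/lclsP/lterm_star_cong/repr_lcls. Qed.

Lemma lpa_star_linear : linear lpa_star.
Proof.
move=> a; elim/lpaW=> t; elim/lpaW=> u.
by rewrite -lclsZ -lclsD !lcls_star /= lclsD lclsZ.
Qed.
Lemma lpa_star_anti x y : lpa_star (x * y) = lpa_star y * lpa_star x.
Proof.
by elim/lpaW: x => t; elim/lpaW: y => u; rewrite -lclsM !lcls_star -lclsM.
Qed.
Lemma lpa_starK : involutive lpa_star.
Proof. by elim/lpaW=> t; rewrite !lcls_star lterm_starK. Qed.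

End LeavittPathAlgebra.

Section Involutions.
Variable F : fieldType.

Record involution (A : algType F) := Involution {
  inv_fun :> A -> A;
  inv_linear : linear inv_fun;
  inv_anti : forall x y, inv_fun (x * y) = inv_fun y * inv_fun x;
  inv_invol : involutive inv_fun }.

Definition involutive_isomorphic (A B : algType F)
    (sA : involution A) (sB : involution B) : Prop :=
  exists2 phi : {lrmorphism A -> B},
    bijective phi & forall a, phi (sA a) = sB (phi a).

Definition std_involution (G : quiver) : involution (lpa F G) :=
  Involution (@lpa_star_linear F G) (@lpa_star_anti F G) (@lpa_starK F G).

End Involutions.

Section Automorphisms.
Variables (F : fieldType) (A : algType F).

Record alg_aut := AlgAut {
  aut_fun :> {lrmorphism A -> A};
  aut_bij : bijective aut_fun }.

HB.instance Definition _ := gen_eqMixin alg_aut.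
HB.instance Definition _ := gen_choiceMixin alg_aut.

Lemma alg_autP (f g : alg_aut) : f =1 g -> f = g.
Proof.
case: f => [[f cf] fb]; case: g => [[g cg] gb] /= fg.
have {}fg : f = g by apply/funext.
case: g / fg cg gb => cg gb.
have cfg : cf = cg.
  case: cf {fb} => [[a] [b] [c]]; case: cg {gb} => [[a'] [b'] [c']].
  by rewrite (Prop_irrelevance a a') (Prop_irrelevance b b')
    (Prop_irrelevance c c').
case: cg / cfg gb => gb.
by rewrite (Prop_irrelevance fb gb).
Qed.

Definition alg_aut1 : alg_aut :=
  AlgAut (aut_fun := idfun) (Bijective (g := id) (frefl _) (frefl _)).

Definition alg_autM (f g : alg_aut) : alg_aut :=
  AlgAut (aut_fun := f \o g) (bij_comp (aut_bij f) (aut_bij g)).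

Lemma alg_aut_inv_subproof (f : alg_aut) :
  exists g : alg_aut, cancel f g /\ cancel g f.
Proof.
have [g fK gK] := aut_bij f.
have gl : linear g by exact: can2_linear fK gK.
have gm : GRing.monoid_morphism g by exact: can2_monoid_morphism fK gK.
pose gA := GRing.isLinear.Build _ _ _ _ g gl.
pose gM := GRing.isMonoidMorphism.Build _ _ g gm.
pose gLR : {lrmorphism A -> A} := HB.pack g gA gM.
by exists (AlgAut (aut_fun := gLR) (Bijective gK fK)).
Qed.

Definition alg_autV (f : alg_aut) : alg_aut := projT1 (cid (alg_aut_inv_subproof f)).

Lemma alg_autVK (f : alg_aut) : cancel f (alg_autV f).
Proof. by rewrite /alg_autV; case: cid => g []. Qed.
Lemma alg_autKV (f : alg_aut) : cancel (alg_autV f) f.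
Proof. by rewrite /alg_autV; case: cid => g []. Qed.

Lemma alg_autMA : associative alg_autM.
Proof. by move=> f g h; apply: alg_autP. Qed.
Lemma alg_aut1M : left_id alg_aut1 alg_autM.
Proof. by move=> f; apply: alg_autP. Qed.
Lemma alg_autM1 : right_id alg_aut1 alg_autM.
Proof. by move=> f; apply: alg_autP. Qed.
Lemma alg_autVM : left_inverse alg_aut1 alg_autV alg_autM.
Proof. by move=> f; apply: alg_autP => x /=; apply: alg_autVK. Qed.
Lemma alg_autMV : right_inverse alg_aut1 alg_autV alg_autM.
Proof. by move=> f; apply: alg_autP => x /=; apply: alg_autKV. Qed.

HB.instance Definition _ := isGroup.Build alg_aut
  alg_autMA alg_aut1M alg_autM1 alg_autVM alg_autMV.

End Automorphisms.

Section UnitGroups.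
Local Open Scope group_scope.

(* The inverse is unique, so carrying it as data adds no elements: see munitP. *)
Record munit (M : monoidType) := MUnit {
  munit_val :> M;
  munit_inv : M;
  munit_mulV : munit_val * munit_inv = 1;
  munit_Vmul : munit_inv * munit_val = 1 }.

Variable M : monoidType.
HB.instance Definition _ := gen_eqMixin (munit M).
HB.instance Definition _ := gen_choiceMixin (munit M).

Lemma munitP (x y : munit M) : munit_val x = munit_val y -> x = y.
Proof.
case: x => x x' xx' x'x; case: y => y y' yy' y'y /= xy.
case: y / xy yy' y'y => yy' y'y.
have E : x' = y' by rewrite -[x']mulg1 -yy' mulgA x'x mul1g.
case: y' / E yy' y'y => yy' y'y.
by rewrite (Prop_irrelevance xx' yy') (Prop_irrelevance x'x y'y).
Qed.

Definition munit1 : munit M := MUnit (mulg1 1) (mulg1 1).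
Definition munitV (x : munit M) : munit M :=
  MUnit (munit_Vmul x) (munit_mulV x).
Lemma munitM_subproof (x y : munit M) :
  munit_val x * munit_val y * (munit_inv y * munit_inv x) = 1.
Proof.
by rewrite mulgA -[_ * munit_inv y]mulgA munit_mulV mulg1 munit_mulV.
Qed.
Lemma munitM_subproof' (x y : munit M) :
  munit_inv y * munit_inv x * (munit_val x * munit_val y) = 1.
Proof. exact: (munitM_subproof (munitV y) (munitV x)). Qed.
Definition munitM (x y : munit M) : munit M :=
  MUnit (munitM_subproof x y) (munitM_subproof' x y).

Lemma munitMA : associative munitM.
Proof. by move=> x y z; apply: munitP; apply: mulgA. Qed.
Lemma munit1M : left_id munit1 munitM.
Proof. by move=> x; apply: munitP; apply: mul1g. Qed.
Lemma munitM1 : right_id munit1 munitM.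
Proof. by move=> x; apply: munitP; apply: mulg1. Qed.
Lemma munitVM : left_inverse munit1 munitV munitM.
Proof. by move=> x; apply: munitP; apply: munit_Vmul. Qed.
Lemma munitMV : right_inverse munit1 munitV munitM.
Proof. by move=> x; apply: munitP; apply: munit_mulV. Qed.

HB.instance Definition _ := isGroup.Build (munit M)
  munitMA munit1M munitM1 munitVM munitMV.
End UnitGroups.

Section FieldUnits.
Variable F : fieldType.

Definition Fstar : Type := {x : F | x != 0}.
HB.instance Definition _ := SubChoice.on Fstar.

Definition Fstar1 : Fstar := exist _ 1 (oner_neq0 F).
Definition FstarM (x y : Fstar) : Fstar :=
  exist _ (val x * val y) (mulf_neq0 (valP x) (valP y)).
Lemma FstarV_subproof (x : Fstar) : (val x)^-1 != 0.
Proof. by rewrite invr_neq0 // (valP x). Qed.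
Definition FstarV (x : Fstar) : Fstar := exist _ (val x)^-1 (FstarV_subproof x).

Lemma FstarMA : associative FstarM.
Proof. by move=> x y z; apply: val_inj; apply: mulrA. Qed.
Lemma Fstar1M : left_id Fstar1 FstarM.
Proof. by move=> x; apply: val_inj; apply: mul1r. Qed.
Lemma FstarM1 : right_id Fstar1 FstarM.
Proof. by move=> x; apply: val_inj; apply: mulr1. Qed.
Lemma FstarVM : left_inverse Fstar1 FstarV FstarM.
Proof. by move=> x; apply: val_inj; apply: (mulVf (valP x)). Qed.
Lemma FstarMV : right_inverse Fstar1 FstarV FstarM.
Proof. by move=> x; apply: val_inj; apply: (mulfV (valP x)). Qed.

HB.instance Definition _ := isGroup.Build Fstar
  FstarMA Fstar1M FstarM1 FstarVM FstarMV.
End FieldUnits.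

Section FinitaryMatrices.
Variable F : fieldType.

Definition imx := nat -> nat -> F.

Definition finite_mx (A : imx) := finite_set [set p | A p.1 p.2 != 0].

Definition imx1 : imx := fun i j => (i == j)%:R.

(* The bigop over an infinite set is the sum over the support of its argument
   when that support is finite (always the case in Id + M_oo(F)), and 0
   otherwise. *)
Definition imxM (A B : imx) : imx :=
  fun i j => \sum_(k \in [set: nat]) A i k * B k j.

(* The monoid Id + M_oo(F). *)
Record IdMoo := mkIdMoo {
  IdMoo_mx :> nat -> nat -> F;
  IdMooP : finite_mx (fun i j => IdMoo_mx i j - imx1 i j) }.

HB.instance Definition _ := gen_eqMixin IdMoo.
HB.instance Definition _ := gen_choiceMixin IdMoo.

Lemma IdMoo_inj (A B : IdMoo) : (forall i j, A i j = B i j) -> A = B.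
Proof.
case: A => A pA; case: B => B pB /= AB.
have E : A = B by apply/funext => i; apply/funext => j.
by case: B / E {AB} pB => pB; rewrite (Prop_irrelevance pA pB).
Qed.

Lemma finite_mxP (A : imx) :
  finite_mx A <->
  exists n, forall i j, ((n <= i) || (n <= j))%N -> A i j = 0.
Proof.
split=> [/finite_seqP[s sE]|[n An]].
  exists (\max_(p <- s) (maxn p.1 p.2).+1)%N => i j; apply: contraTeq => Aij.
  have ijs : (i, j) \in s.
    by have : [set` s] (i, j) by rewrite -sE.
  have /= := @leq_bigmax_seq _ s xpredT (fun p => (maxn p.1 p.2).+1) _ ijs isT.
  by rewrite negb_or -!ltnNge -gtn_max.
apply: (@sub_finite_set _ _ (`I_n `*` `I_n)); last first.
  by apply: finite_setX; apply: finite_II.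
move=> [i j] /= Aij; split => /=.
  by rewrite ltnNge; apply: contra Aij => ni; rewrite An ?ni.
by rewrite ltnNge; apply: contra Aij => nj; rewrite An ?nj ?orbT.
Qed.

Lemma IdMoo_bound (A : IdMoo) :
  exists n, forall i j, ((n <= i) || (n <= j))%N -> A i j = imx1 i j.
Proof.
have [n An] := (finite_mxP _).1 (IdMooP A).
by exists n => i j nij; apply/eqP; rewrite -subr_eq0 An.
Qed.

Lemma imxME (A B : imx) i j m : (forall k, (m <= k)%N -> A i k = 0) ->
  imxM A B i j = \sum_(k < m) A i k * B k j.
Proof.
move=> Aik; rewrite (fsbig_ord _ m (fun k => A i k * B k j)) /imxM.
apply/esym/fsbig_widen => // k [_ /= /negP]; rewrite -leqNgt => mk.
by rewrite /= Aik // mul0r.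
Qed.

Lemma imxMr_bound (A B : imx) n i j :
  (forall i j, ((n <= i) || (n <= j))%N -> A i j = imx1 i j) ->
  (forall i j, ((n <= i) || (n <= j))%N -> B i j = imx1 i j) ->
  ((n <= i) || (n <= j))%N -> imxM A B i j = imx1 i j.
Proof.
move=> An Bn nij.
have Ak k : (maxn n i.+1 <= k)%N -> A i k = 0.
  by rewrite geq_max => /andP[nk ik]; rewrite An ?nk ?orbT // /imx1 ltn_eqF.
rewrite (imxME _ _ Ak).
have iM : (i < maxn n i.+1)%N by rewrite leq_max ltnSn orbT.
case: (leqP n i) nij => [ni _|ni /= nj].
  rewrite (bigD1 (Ordinal iM)) //= An ?ni // /imx1 eqxx mul1r Bn ?ni //.
  rewrite big1 ?addr0 // => k ki; rewrite An ?ni // /imx1.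
  by rewrite eq_sym -val_eqE in ki *; rewrite (negPf ki) mul0r.
under eq_bigr do rewrite Bn ?nj ?orbT //.
have [jM|Mj] := ltnP j (maxn n i.+1).
  rewrite (bigD1 (Ordinal jM)) //= /imx1 eqxx mulr1 An ?nj ?orbT //.
  rewrite big1 ?addr0 // => k kj.
  by rewrite -val_eqE /= in kj *; rewrite (negPf kj) mulr0.
rewrite big1 => [|k _]; first by rewrite /imx1 ltn_eqF // (leq_trans iM).
by rewrite /imx1 ltn_eqF ?mulr0 // (leq_trans (ltn_ord k)).
Qed.

Lemma IdMoo1_subproof : finite_mx (fun i j => imx1 i j - imx1 i j).
Proof. by apply/finite_mxP; exists 0%N => i j _; rewrite subrr. Qed.
Definition IdMoo1 : IdMoo := mkIdMoo IdMoo1_subproof.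

Lemma IdMooM_subproof (A B : IdMoo) :
  finite_mx (fun i j => imxM A B i j - imx1 i j).
Proof.
have [n An] := IdMoo_bound A; have [m Bm] := IdMoo_bound B.
apply/finite_mxP; exists (maxn n m) => i j nij; apply/eqP; rewrite subr_eq0.
apply/eqP; apply: (imxMr_bound _ _ nij) => {nij i j} i j; rewrite !geq_max => nij.
  by apply: An; case/orP: nij => /andP[-> _]; rewrite ?orbT.
by apply: Bm; case/orP: nij => /andP[_ ->]; rewrite ?orbT.
Qed.
Definition IdMooM (A B : IdMoo) : IdMoo := mkIdMoo (IdMooM_subproof A B).

Lemma IdMoo_row (A : IdMoo) :
  exists n, forall M i k, (n <= M)%N -> (i < M)%N -> (M <= k)%N -> A i k = 0.
Proof.
have [n An] := IdMoo_bound A; exists n => M i k nM iM Mk.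
by rewrite An ?(leq_trans nM Mk) ?orbT // /imx1 ltn_eqF // (leq_trans iM).
Qed.

Lemma IdMooMA : associative IdMooM.
Proof.
move=> A B C; apply: IdMoo_inj => i j /=.
have [a Aa] := IdMoo_row A; have [b Bb] := IdMoo_row B.
have [c Cc] := IdMoo_row (IdMooM A B).
pose M := (a + b + c + i.+1)%N.
have aM : (a <= M)%N by rewrite /M -!addnA leq_addr.
have bM : (b <= M)%N by rewrite /M [(a + b)%N]addnC -!addnA leq_addr.
have cM : (c <= M)%N by rewrite /M [(a + b + c)%N]addnC -!addnA leq_addr.
have iM : (i < M)%N by rewrite /M leq_addl.
rewrite (@imxME A _ i j M) => [|k]; last exact: Aa.
rewrite (@imxME (imxM A B) _ i j M) => [|k]; last exact: Cc.
under eq_bigr => k _.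
  rewrite (@imxME B _ k j M) => [|l]; last exact: Bb.
  rewrite mulr_sumr; over.
rewrite exchange_big; apply: eq_bigr => l _ /=.
rewrite (@imxME A _ i l M) => [|k]; last exact: Aa.
by rewrite mulr_suml; apply: eq_bigr => k _; rewrite mulrA.
Qed.

Lemma IdMoo1M : left_id IdMoo1 IdMooM.
Proof.
move=> A; apply: IdMoo_inj => i j /=.
rewrite (@imxME imx1 _ i j i.+1) => [|k ik]; last by rewrite /imx1 ltn_eqF.
rewrite (bigD1 ord_max) //= /imx1 eqxx mul1r big1 ?addr0 // => k ki.
by rewrite -val_eqE /= eq_sym in ki; rewrite (negPf ki) mul0r.
Qed.

Lemma IdMooM1 : right_id IdMoo1 IdMooM.
Proof.
move=> A; apply: IdMoo_inj => i j /=.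
have [a Aa] := IdMoo_row A; pose M := (a + i.+1 + j.+1)%N.
have jM : (j < M)%N by rewrite /M leq_addl.
rewrite (@imxME A _ i j M) => [|k]; last first.
  by apply: Aa; rewrite /M -?addnA ?leq_addr // addnCA leq_addr.
rewrite (bigD1 (Ordinal jM)) //= /imx1 eqxx mulr1 big1 ?addr0 // => k kj.
by rewrite -val_eqE /= in kj; rewrite (negPf kj) mulr0.
Qed.

HB.instance Definition _ := isMonoid.Build IdMoo IdMooMA IdMoo1M IdMooM1.

Definition GLoo := munit IdMoo.
HB.instance Definition _ := Group.on GLoo.

End FinitaryMatrices.

Section SemidirectProduct.
Local Open Scope group_scope.

Record group_action (H N : groupType) := GroupAction {
  gact :> H -> N -> N;
  gactMr : forall h, {morph gact h : x y / x * y};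
  gact1l : forall x, gact 1 x = x;
  gactMl : forall g h x, gact (g * h) x = gact g (gact h x) }.

(* H |x N with N normal; SDProd n h stands for the product n h, so that the
   action is conjugation: h n h^-1 = theta h n. *)
Record sdprod (H N : groupType) (theta : group_action H N) := SDProd {
  sd_normal : N;
  sd_compl : H }.

Variables (H N : groupType) (theta : group_action H N).
Local Notation sd := (sdprod theta).
Local Notation SD := (SDProd theta).

HB.instance Definition _ := gen_eqMixin sd.
HB.instance Definition _ := gen_choiceMixin sd.

Lemma gact1r h : theta h 1 = 1.
Proof. by apply: (mulgI (theta h 1)); rewrite -gactMr !mulg1. Qed.

Definition sd1 : sd := SD 1 1.
Definition sdM (x y : sd) : sd :=
  SD (sd_normal x * theta (sd_compl x) (sd_normal y)) (sd_compl x * sd_compl y).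
Definition sdV (x : sd) : sd :=
  SD (theta (sd_compl x)^-1 (sd_normal x)^-1) (sd_compl x)^-1.

Lemma sdMA : associative sdM.
Proof.
by move=> [n h] [m g] [l k]; rewrite /sdM /= gactMr gactMl !mulgA.
Qed.
Lemma sd1M : left_id sd1 sdM.
Proof. by move=> [n h]; rewrite /sdM /= gact1l !mul1g. Qed.
Lemma sdM1 : right_id sd1 sdM.
Proof. by move=> [n h]; rewrite /sdM /= gact1r !mulg1. Qed.
Lemma sdVM : left_inverse sd1 sdV sdM.
Proof. by move=> [n h]; rewrite /sdM /= -gactMr !mulVg gact1r. Qed.
Lemma sdMV : right_inverse sd1 sdV sdM.
Proof. by move=> [n h]; rewrite /sdM /= -gactMl !mulgV gact1l mulgV. Qed.

HB.instance Definition _ := isGroup.Build sd sdMA sd1M sdM1 sdVM sdMV.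
End SemidirectProduct.

Definition group_isomorphic (G H : groupType) : Prop :=
  exists2 f : G -> H, bijective f & {morph f : x y / (x * y)%g}.

Variant Gamma1_vertex := v1 | v2.
Variant Gamma1_edge := edge_c | edge_e.

Definition bool_of_vertex x := if x is v1 then false else true.
Definition vertex_of_bool b := if b then v2 else v1.
Lemma bool_of_vertexK : cancel bool_of_vertex vertex_of_bool.
Proof. by case. Qed.
HB.instance Definition _ := Finite.copy Gamma1_vertex (can_type bool_of_vertexK).

Definition bool_of_edge x := if x is edge_c then false else true.
Definition edge_of_bool b := if b then edge_e else edge_c.
Lemma bool_of_edgeK : cancel bool_of_edge edge_of_bool.
Proof. by case. Qed.
HB.instance Definition _ := Finite.copy Gamma1_edge (can_type bool_of_edgeK).

Lemma Gamma1_vertex_gt0 : (0 < #|{: Gamma1_vertex}|)%N.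
Proof. by apply/card_gt0P; exists v1. Qed.

Definition Gamma1 : quiver :=
  @Quiver Gamma1_vertex Gamma1_edge
    (fun _ => v1) (fun x => if x is edge_c then v1 else v2) Gamma1_vertex_gt0.

(* Main.v *)
Require Import Defs.
From HB Require Import structures.
From mathcomp Require Import all_boot all_order all_algebra perm.
From mathcomp Require Import all_classical zify.
Set Implicit Arguments.
Unset Strict Implicit.
Unset Printing Implicit Defensive.
Import GRing.Theory.
Local Open Scope ring_scope.

(** Put [x = c + e] and [y = c^* + e^*].  Then [y x = 1] and [1 - x y] is the
    vertex [v2], so the algebra [L] is the Toeplitz algebra generated by a
    one-sided inverse.  It acts on the polynomials [V] by letting [x] multiply by
    the variable and [y] divide by it, dropping the constant term.  The action is
    faithful ([act_faithful]), and its image consists of the linear operators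
    that agree with multiplication by a fixed polynomial, up to a shift of the
    degree, on all multiples of some power of the variable ([tail_poly],
    [act_realize]).  So [L] is described by two data: a tail, which is a Laurent
    polynomial, and a finite number of free matrix columns.

    Automorphisms.  [V] is the left ideal generated by the idempotent
    [q = 1 - x y], and this makes every automorphism [f] the conjugation by a
    linear bijection [T] of [V] ([automorphism_spatial]).  The tail of [f x]
    divides a power of the variable, because [f y] is a left inverse, so it is
    [c X^d]; [d] is at least [0] as otherwise the vectors [T X^i] would have
    bounded degree; and the exponents of [f] and of its inverse multiply to [1],
    so that [d = 1] ([automorphism_shift]).  After composition with the gauge
    automorphism of parameter [c^-1] one has [c = 1], and then [T] and its inverse
    satisfy the criterion for being given by elements of [L]: they are a unit [u]
    of [L] ([tame_intertwiner]).  A unit has index zero, so its tail is a nonzero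
    scalar, which can be divided out ([unit_tail]).  What is left is a unit
    equal to the identity far from the origin, that is, an element of the
    finitary linear group.  Hence every automorphism is in a unique way the
    composite of a conjugation by a finitary unit and a gauge automorphism
    ([conj_gauge_trivial]), and gauge automorphisms normalize these conjugations:
    this is the semidirect product.

    Involutions.  An involution composed with the standard one is an automorphism,
    hence reads [s |-> u (gauge a s^* ) u^-1].  Conjugating by the gauge
    automorphism of a square root of [a] one may take [a = 1].  Applying the
    involution twice shows that [u (u^* )^-1] is central, and a finitary central
    element is [1]; so [u] is a symmetric matrix.  It is congruent to the identity:
    over a field in which every element is a square this holds for all invertible
    symmetric matrices that are not alternating ([orthonormal_basis]), and [u] has
    ones on the diagonal far from the origin.  If [u = p p^*], conjugation by
    [p^-1] carries the involution to the standard one. *)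

(** * The gauge action of the multiplicative group *)

Section Gauge.
Variables (F : fieldType) (G : quiver).
Local Notation L := (lpa F G).

(** The generator [e] has degree [1] and [e^*] degree [-1]: on elements of degree
    [d] the gauge automorphism multiplies by [a ^ d]. *)
Fixpoint lterm_gauge (a : F) (t : lterm F G) : lterm F G :=
  match t with
  | Vert v => Vert F v
  | Edge e => Scale a (Edge F e)
  | Ghost e => Scale a^-1 (Ghost F e)
  | Zero => Zero F G
  | Add t u => Add (lterm_gauge a t) (lterm_gauge a u)
  | Scale b t => Scale b (lterm_gauge a t)
  | Mul t u => Mul (lterm_gauge a t) (lterm_gauge a u)
  end.

(** The standard involution reverses the grading. *)
Lemma lterm_star_gauge a t :
  lterm_star (lterm_gauge a t) = lterm_gauge a^-1 (lterm_star t).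
Proof. by elim: t => //= [e|t -> u ->|b t ->|t -> u ->]; rewrite ?invrK. Qed.

Lemma lterm_gauge_cong a t u : a != 0 ->
  lcong t u -> lcong (lterm_gauge a t) (lterm_gauge a u).
Proof.
move=> a0; elim=> {t u}; try by constructor.
- by move=> t u w _ tu _ uw; apply: lc_trans tu uw.
- by move=> v w /=; have := lc_vert F v w; case: ifP.
- move=> e /=; apply/lclsP; rewrite lclsM lclsZ -scalerAr -lclsM.
  by congr (_ *: _); apply/lclsP/lc_srcE.
- move=> e /=; apply/lclsP; rewrite lclsM lclsZ -scalerAl -lclsM.
  by congr (_ *: _); apply/lclsP/lc_tgtE.
- move=> e /=; apply/lclsP; rewrite lclsM lclsZ -scalerAr -lclsM.
  by congr (_ *: _); apply/lclsP/lc_tgtG.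
- move=> e /=; apply/lclsP; rewrite lclsM lclsZ -scalerAl -lclsM.
  by congr (_ *: _); apply/lclsP/lc_srcG.
- move=> e f /=; apply/lclsP; rewrite lclsM !lclsZ -scalerAl -scalerAr scalerA.
  rewrite mulVf // scale1r -lclsM; have /lclsP -> := lc_ck1 F e f.
  by case: ifP.
- move=> v ve; rewrite (big_morph (lterm_gauge a) (id1 := @Zero F G) (op1 := @Add F G)) //=.
  apply/lclsP; have /lclsP -> := lc_ck2 F ve; rewrite !lcls_sum.
  apply: eq_bigr => e _; rewrite !lclsM !lclsZ -scalerAl -scalerAr scalerA.
  by rewrite mulfV // scale1r.
Qed.

Definition gauge (a : Fstar F) (s : L) : L := lcls (lterm_gauge (val a) (repr s)).

Lemma gauge_lcls a t : gauge a (lcls t) = lcls (lterm_gauge (val a) t).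
Proof. by apply/lclsP/lterm_gauge_cong/repr_lcls/(valP a). Qed.

Lemma gauge_is_linear a : linear (gauge a).
Proof.
move=> k; elim/lpaW=> t; elim/lpaW=> u.
by rewrite -lclsZ -lclsD !gauge_lcls /= lclsD lclsZ.
Qed.

Lemma gauge_is_monoid_morphism a : GRing.monoid_morphism (gauge a).
Proof.
split; last first.
  by elim/lpaW=> t; elim/lpaW=> u; rewrite -lclsM !gauge_lcls /= lclsM.
rewrite [1](_ : _ = lpa_one F G) // /lpa_one gauge_lcls.
by rewrite (big_morph (lterm_gauge (val a)) (id1 := @Zero F G) (op1 := @Add F G)).
Qed.

HB.instance Definition _ a :=
  GRing.isLinear.Build F L L *:%R (gauge a) (gauge_is_linear a).
HB.instance Definition _ a :=
  GRing.isMonoidMorphism.Build L L (gauge a) (gauge_is_monoid_morphism a).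

Lemma gauge1 s : gauge 1%g s = s.
Proof.
elim/lpaW: s => t; rewrite gauge_lcls /=.
elim: t => //= [e|e|t IHt u IHu|b t IH|t IHt u IHu].
- by rewrite lclsZ scale1r.
- by rewrite lclsZ invr1 scale1r.
- by rewrite !lclsD IHt IHu.
- by rewrite !lclsZ IH.
- by rewrite !lclsM IHt IHu.
Qed.

Lemma gaugeM a b s : gauge (a * b)%g s = gauge a (gauge b s).
Proof.
elim/lpaW: s => t; rewrite !gauge_lcls /=.
elim: t => //= [e|e|t IHt u IHu|c t IH|t IHt u IHu].
- by rewrite !lclsZ scalerA mulrC.
- by rewrite !lclsZ scalerA invfM mulrC.
- by rewrite !lclsD IHt IHu.
- by rewrite !lclsZ IH.
- by rewrite !lclsM IHt IHu.
Qed.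

Lemma gaugeK a : cancel (gauge a) (gauge a^-1%g).
Proof. by move=> s; rewrite -gaugeM mulVg gauge1. Qed.

Lemma gaugeKV a : cancel (gauge a^-1%g) (gauge a).
Proof. by move=> s; rewrite -gaugeM mulgV gauge1. Qed.

Lemma star_gauge a s : lpa_star (gauge a s) = gauge a^-1%g (lpa_star s).
Proof.
elim/lpaW: s => t.
by rewrite gauge_lcls !lcls_star gauge_lcls lterm_star_gauge.
Qed.

Definition gauge_aut a : alg_aut L :=
  AlgAut (aut_fun := gauge a) (Bijective (gaugeK a) (gaugeKV a)).

End Gauge.

(** * Inner automorphisms *)

Section Inner.
Variables (F : fieldType) (A : algType F).

Definition conj_fun (u v : A) of u * v = 1 & v * u = 1 := fun s : A => u * s * v.

Variables (u v : A) (uv : u * v = 1) (vu : v * u = 1).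
Local Notation f := (conj_fun uv vu).

Lemma conj_is_linear : linear f.
Proof. by move=> k a b; rewrite /conj_fun mulrDr mulrDl -scalerAr -scalerAl. Qed.

Lemma conj_is_monoid_morphism : GRing.monoid_morphism f.
Proof.
split=> [|a b]; rewrite /conj_fun; first by rewrite mulr1.
by rewrite !mulrA -(mulrA (u * a) v u) vu mulr1.
Qed.

HB.instance Definition _ := GRing.isLinear.Build F A A *:%R f conj_is_linear.
HB.instance Definition _ :=
  GRing.isMonoidMorphism.Build A A f conj_is_monoid_morphism.

Lemma conj_bij : bijective f.
Proof.
exists (fun s => v * s * u) => s; rewrite /conj_fun !mulrA.
  by rewrite vu mul1r -mulrA vu mulr1.
by rewrite uv mul1r -mulrA uv mulr1.
Qed.

Definition conj_aut : alg_aut A := AlgAut (aut_fun := f) conj_bij.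

End Inner.

(** * The algebra as the Toeplitz algebra *)

Section Toeplitz.
Variable F : fieldType.
Local Notation L := (lpa F Gamma1).
Local Notation V := {poly F}.

Definition vtx (v : Gamma1_vertex) : L := lcls (@Vert F Gamma1 v).
Definition arr (f : Gamma1_edge) : L := lcls (@Edge F Gamma1 f).
Definition gho (f : Gamma1_edge) : L := lcls (@Ghost F Gamma1 f).

(** These are the two shifts, with [shiftL * shiftR = 1]; together they generate
    the algebra. *)
Definition shiftR : L := arr edge_c + arr edge_e.
Definition shiftL : L := gho edge_c + gho edge_e.
(** The defect [1 - shiftR * shiftL], which is also a vertex. *)
Definition corank1 : L := vtx v2.
Local Notation x := shiftR.
Local Notation y := shiftL.
Local Notation q := corank1.

Lemma vtxM v w : vtx v * vtx w = if v == w then vtx v else 0.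
Proof. exact: lcls_vert. Qed.

Lemma arr_vtx f : arr f * vtx (@tgt Gamma1 f) = arr f.
Proof. by rewrite -lclsM; apply/lclsP/(lc_tgtE F (G := Gamma1)). Qed.

Lemma vtx_gho f : vtx (@tgt Gamma1 f) * gho f = gho f.
Proof. by rewrite -lclsM; apply/lclsP/(lc_tgtG F (G := Gamma1)). Qed.

Lemma gho_arr f g : gho f * arr g = if f == g then vtx (@tgt Gamma1 f) else 0.
Proof.
by rewrite -lclsM; have /lclsP := lc_ck1 F (G := Gamma1) f g; case: ifP.
Qed.

Lemma vtx_sum : vtx v1 + vtx v2 = 1.
Proof.
rewrite [1](_ : _ = lpa_one F Gamma1) // /lpa_one lcls_sum.
rewrite (bigD1 (v1 : vertex Gamma1)) //= (bigD1 (v2 : vertex Gamma1)) //=.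
by rewrite big1 ?addr0 //; case.
Qed.

Lemma ck2 : vtx v1 = arr edge_c * gho edge_c + arr edge_e * gho edge_e.
Proof.
rewrite /vtx; have /lclsP -> := @lc_ck2 F Gamma1 v1 (ex_intro _ edge_c erefl).
rewrite lcls_sum (bigD1 (edge_c : edge Gamma1)) //=.
rewrite (bigD1 (edge_e : edge Gamma1)) //= big1 ?addr0 ?lclsM //.
by case.
Qed.

Lemma shiftLR : y * x = 1.
Proof.
by rewrite mulrDl !mulrDr !gho_arr /= addr0 add0r vtx_sum.
Qed.

Lemma arr_gho f g : f != g -> arr f * gho g = 0.
Proof.
move=> fg; rewrite -(arr_vtx f) -(vtx_gho g) mulrA -(mulrA (arr f)) vtxM.
by case: f g fg => [] [] //= _; rewrite mulr0 mul0r.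
Qed.

Lemma shiftRL : x * y = vtx v1.
Proof.
rewrite mulrDl !mulrDr (@arr_gho edge_c edge_e) // (@arr_gho edge_e edge_c) //.
by rewrite addr0 add0r ck2.
Qed.

Lemma corank1E : q = 1 - x * y.
Proof. by rewrite shiftRL -vtx_sum addrC addKr. Qed.

Lemma corank1_shiftR : q * x = 0.
Proof. by rewrite corank1E mulrBl mul1r -mulrA shiftLR mulr1 subrr. Qed.

Lemma shiftL_corank1 : y * q = 0.
Proof. by rewrite corank1E mulrBr mulr1 mulrA shiftLR mul1r subrr. Qed.

Lemma corank1M : q * q = q.
Proof. by rewrite {2}corank1E mulrBr mulr1 mulrA corank1_shiftR mul0r subr0. Qed.

Lemma arr_cE : arr edge_c = x * (x * y).
Proof.
rewrite shiftRL mulrDl (arr_vtx edge_c) -(arr_vtx edge_e) -mulrA vtxM mulr0.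
by rewrite addr0.
Qed.

Lemma arr_eE : arr edge_e = x * q.
Proof.
rewrite mulrDl (arr_vtx edge_e) -(arr_vtx edge_c) -mulrA vtxM mulr0.
by rewrite add0r.
Qed.

Lemma gho_cE : gho edge_c = x * y * y.
Proof.
rewrite shiftRL mulrDr (vtx_gho edge_c) -(vtx_gho edge_e) mulrA vtxM mul0r.
by rewrite addr0.
Qed.

Lemma gho_eE : gho edge_e = q * y.
Proof.
rewrite mulrDr (vtx_gho edge_e) -(vtx_gho edge_c) mulrA vtxM mul0r.
by rewrite add0r.
Qed.

(** Vertices and arrows are words in [x] and [y], so that inductions on [L] need only these
    two generators. *)
Lemma shift_ind (P : L -> Prop) :
  P 1 -> P x -> P y -> (forall a b, P a -> P b -> P (a + b)) ->
  (forall k a, P a -> P (k *: a)) -> (forall a b, P a -> P b -> P (a * b)) ->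
  forall a, P a.
Proof.
move=> P1 Px Py PD PZ PM; have Pq : P q.
  by rewrite corank1E -scaleN1r; apply: PD => //; apply: PZ; apply: PM.
elim/lpaW; elim=> [[]|[]|[]||t Pt u Pu|k t Pt|t Pt u Pu].
- by rewrite -/(vtx v1) -shiftRL; apply: PM.
- exact: Pq.
- by rewrite -/(arr edge_c) arr_cE; do 2?[apply: (PM) => //].
- by rewrite -/(arr edge_e) arr_eE; apply: PM.
- by rewrite -/(gho edge_c) gho_cE; do 2?[apply: (PM) => //].
- by rewrite -/(gho edge_e) gho_eE; apply: PM.
- by rewrite lcls0 -(scale0r 1); apply: PZ.
- by rewrite lclsD; apply: PD.
- by rewrite lclsZ; apply: PZ.
- by rewrite lclsM; apply: PM.
Qed.

(** * The action on polynomials *)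

(** The shifts act by multiplication and truncated division by the variable; the
    values on arrows are those of the corresponding words in the shifts. *)
Fixpoint ract (t : lterm F Gamma1) (p : V) : V :=
  match t with
  | Vert v1 => drop_poly 1 p * 'X
  | Vert v2 => (p`_0)%:P
  | Edge edge_c => drop_poly 1 p * 'X^2
  | Edge edge_e => p`_0 *: 'X
  | Ghost edge_c => drop_poly 2 p * 'X
  | Ghost edge_e => (p`_1)%:P
  | Zero => 0
  | Add t u => ract t p + ract u p
  | Scale a t => a *: ract t p
  | Mul t u => ract t (ract u p)
  end.

Lemma ract_linear t : linear (ract t).
Proof.
elim: t => [[]|[]|[]||t IHt u IHu|a t IH|t IHt u IHu] k p r /=.
- by rewrite linearP mulrDl scalerAl.
- by rewrite coefD coefZ polyCD polyCM mul_polyC.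
- by rewrite linearP mulrDl scalerAl.
- by rewrite coefD coefZ scalerDl scalerA.
- by rewrite linearP mulrDl scalerAl.
- by rewrite coefD coefZ polyCD polyCM mul_polyC.
- by rewrite scaler0 addr0.
- by rewrite IHt IHu scalerDr addrACA.
- by rewrite IH scalerDr !scalerA mulrC.
- by rewrite IHu IHt.
Qed.

Lemma ract_sum (I : Type) (r : seq I) (P : pred I) (f : I -> lterm F Gamma1) p :
  ract (\big[@Add F Gamma1/@Zero F Gamma1]_(i <- r | P i) f i) p
  = \sum_(i <- r | P i) ract (f i) p.
Proof. by apply: (big_morph (fun t => ract t p)). Qed.

Ltac coef_cases := let p := fresh in let i := fresh in
  move=> p; apply/polyP => i; rewrite /= !coefE;
  case: i => [|[|i]];
  rewrite ?(subSS, subn0, addn1, addn0, addn2, add0n, mulr0, mulr1, addr0, add0r) //=.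

Lemma ract_sound t u : lcong t u -> ract t =1 ract u.
Proof.
have X2 (p : V) : p * 'X^2 = p * 'X * 'X by rewrite -mulrA.
elim => {t u} //=.
- by move=> t u _ IH p.
- by move=> t u w _ IH1 _ IH2 p; rewrite IH1 IH2.
- by move=> t t' u u' _ IH1 _ IH2 p; rewrite IH1 IH2.
- by move=> a t t' _ IH p; rewrite IH.
- by move=> t t' u u' _ IH1 _ IH2 p; rewrite IH1 IH2.
- by move=> * p; rewrite addrA.
- by move=> * p; rewrite addrC.
- by move=> * p; rewrite add0r.
- by move=> * p; rewrite scaleN1r addNr.
- by move=> * p; rewrite scalerA.
- by move=> * p; rewrite scale1r.
- by move=> * p; rewrite scalerDr.
- by move=> * p; rewrite scalerDl.
- by move=> t u w p; have /= := ract_linear t 1 (ract u p) (ract w p);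
    rewrite !scale1r.
- move=> a t u p; have := ract_linear t a (ract u p) 0.
  have -> : ract t 0 = 0.
    by have := ract_linear t (-1) 0 0; rewrite scaler0 addr0 scaleN1r addNr.
  by rewrite !addr0.
- by move=> [] []; coef_cases.
- by move=> []; coef_cases.
- by move=> []; coef_cases.
- by move=> []; coef_cases.
- by move=> []; coef_cases.
- by move=> [] []; coef_cases.
- move=> [[e0 _] p|[e0 e0v] //]; rewrite ract_sum.
  rewrite (bigD1 (edge_c : edge Gamma1)) //=.
  rewrite (bigD1 (edge_e : edge Gamma1)) //= big1 ?addr0; last by case.
  by move: p; coef_cases.
Qed.

Definition act (a : L) (p : V) : V := ract (repr a) p.

Lemma act_lcls t p : act (lcls t) p = ract t p.
Proof. exact: (ract_sound (repr_lcls t)). Qed.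

Lemma act_is_linear a : linear (act a).
Proof. exact: ract_linear. Qed.

HB.instance Definition _ a :=
  GRing.isLinear.Build F V V *:%R (act a) (act_is_linear a).

Lemma actD a b p : act (a + b) p = act a p + act b p.
Proof. by elim/lpaW: a => t; elim/lpaW: b => u; rewrite -lclsD !act_lcls. Qed.

Lemma actZ k a p : act (k *: a) p = k *: act a p.
Proof. by elim/lpaW: a => t; rewrite -lclsZ !act_lcls. Qed.

Lemma actM a b p : act (a * b) p = act a (act b p).
Proof. by elim/lpaW: a => t; elim/lpaW: b => u; rewrite -lclsM !act_lcls. Qed.

Lemma act0 p : act 0 p = 0.
Proof. by rewrite -[0](scale0r 1) actZ scale0r. Qed.

Lemma act_sum (I : Type) (r : seq I) (P : pred I) (f : I -> L) p :
  act (\sum_(i <- r | P i) f i) p = \sum_(i <- r | P i) act (f i) p.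
Proof. exact: (big_morph (act^~ p) (fun a b => actD a b p) (act0 p)). Qed.

Lemma act_shiftR p : act x p = p * 'X.
Proof.
rewrite actD !act_lcls /=; apply/polyP => i; rewrite !coefE.
by case: i => [|[|i]]; rewrite ?(mulr0, mulr1, addr0, add0r) ?subSS ?subn0 ?addn1.
Qed.

Lemma act_shiftL p : act y p = drop_poly 1 p.
Proof.
rewrite actD !act_lcls /=; apply/polyP => i; rewrite !coefE.
by case: i => [|[|i]]; rewrite ?(addr0, add0r) ?addn1 ?addn2.
Qed.

Lemma act_corank1 p : act q p = (p`_0)%:P.
Proof. exact: act_lcls. Qed.

Lemma act1 p : act 1 p = p.
Proof.
rewrite -shiftLR actM act_shiftR act_shiftL.
by apply/polyP => i; rewrite !coefE addn1.
Qed.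

Lemma act_shiftRX n p : act (x ^+ n) p = p * 'X^n.
Proof.
elim: n p => [|n IH] p; first by rewrite !expr0 act1 mulr1.
by rewrite exprSr actM act_shiftR IH -mulrA exprS.
Qed.

Lemma act_shiftLX n p : act (y ^+ n) p = drop_poly n p.
Proof.
elim: n p => [|n IH] p; first by rewrite expr0 act1 drop_poly0l.
rewrite exprSr actM act_shiftL IH; apply/polyP => i.
by rewrite !coefE -addnA addn1.
Qed.

(** * The image of the action *)

Notation px := (horner_alg x).

Lemma act_px p r : act (px p) r = r * p.
Proof.
elim/poly_ind: p r => [|p c IH] r; first by rewrite raddf0 act0 mulr0.
rewrite rmorphD rmorphM /= horner_algX horner_algC actD actM act_shiftR IH.
by rewrite actZ act1 mulrDr -mul_polyC -mulrA ['X * p]mulrC [_%:P * _]mulrC.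
Qed.

Lemma px_inj : injective px.
Proof.
by move=> p r /(congr1 (act^~ 1)); rewrite !act_px !mul1r.
Qed.

Lemma pxXn n : px 'X^n = x ^+ n.
Proof. by rewrite rmorphXn /= horner_algX. Qed.

Lemma px_comm p r : px p * px r = px r * px p.
Proof. by rewrite -!rmorphM mulrC. Qed.

Lemma px_shiftR p : px p * x = x * px p.
Proof. by have := px_comm p 'X; rewrite horner_algX. Qed.

Lemma poly_drop1 (p : V) : p = drop_poly 1 p * 'X + (p`_0)%:P.
Proof.
apply/polyP => i; rewrite !coefE.
by case: i => [|i]; rewrite ?add0r ?addr0 ?subn1 ?addn1.
Qed.

(** This identifies [V] with the left ideal [L * q], through [p |-> px p * q]: it
    holds on [x] because [px p] commutes with it, and on [y] because [y * x = 1]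
    while [y] kills the constant term, [y * q] being [0]. *)
Lemma px_corank1 a p : a * px p * q = px (act a p) * q.
Proof.
elim/shift_ind: a p => [p|p|p|a b IH IH' p|k a IH p|a b IH IH' p].
- by rewrite mul1r act1.
- by rewrite act_shiftR rmorphM /= horner_algX px_shiftR.
- rewrite act_shiftL {1}[p]poly_drop1 rmorphD rmorphM /= horner_algX horner_algC.
  rewrite mulrDr -scalerAr mulr1 mulrDl -scalerAl shiftL_corank1 scaler0 addr0.
  by rewrite px_shiftR mulrA shiftLR mul1r.
- by rewrite !mulrDl IH IH' actD rmorphD /= mulrDl.
- by rewrite -!scalerAl IH actZ linearZ /= mulr_algl -scalerAl.
- by rewrite actM -IH -!mulrA [b * _]mulrA IH'.
Qed.

(** Each [y] occurring in a word is cancelled by an [x] on its right, so that a high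
    power of [x] turns every element into a polynomial in [x]. *)
Lemma tail_poly a : exists N p, a * x ^+ N = px p.
Proof.
elim/shift_ind: a => [|||a b [N [p ap]] [M [r br]]|k a [N [p ap]]
  |a b [N [p ap]] [M [r br]]].
- by exists 0, 1; rewrite mulr1 rmorph1.
- by exists 0, 'X; rewrite mulr1 horner_algX.
- by exists 1%N, 1; rewrite expr1 shiftLR rmorph1.
- exists (N + M)%N, (p * 'X^M + r * 'X^N).
  rewrite mulrDl {2}addnC !exprD !mulrA ap br.
  by rewrite rmorphD !rmorphM /= !pxXn.
- by exists N, (k *: p); rewrite -scalerAl ap linearZ /= mulr_algl.
- exists (M + N)%N, (p * r).
  by rewrite exprD !mulrA -[_ * x ^+ M]mulrA br -mulrA -pxXn px_comm mulrA pxXn ap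
    -rmorphM.
Qed.

(** The idempotents that project to the monomials of degree less than [n] and to
    the multiples of ['X^n]. *)
Lemma one_split n : 1 = \sum_(i < n) x ^+ i * q * y ^+ i + x ^+ n * y ^+ n.
Proof.
elim: n => [|n IH]; first by rewrite big_ord0 add0r mulr1.
rewrite big_ord_recr /= -addrA {1}IH; congr (_ + _).
rewrite corank1E mulrBr mulr1 mulrBl exprSr exprS !mulrA.
by rewrite addrNK.
Qed.

(** The tail of an element is determined by its action, and so are its products
    with the [x ^+ i * q * y ^+ i] by [px_corank1]; [one_split] recovers the element
    from these. *)
Lemma act_faithful a b : act a =1 act b -> a = b.
Proof.
move=> ab; apply/eqP; rewrite -subr_eq0; apply/eqP.
have {ab}: forall p, act (a - b) p = 0.
  by move=> p; rewrite -scaleN1r actD actZ scaleN1r ab subrr.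
move: (a - b) => c {a b} c0; have [N [p cp]] := tail_poly c.
have p0 : p = 0.
  by rewrite -[p]mul1r -act_px -cp actM c0.
rewrite -[c]mulr1 (one_split N) mulrDr mulrA cp p0 rmorph0 mul0r addr0.
rewrite mulr_sumr big1 // => i _.
by rewrite !mulrA -pxXn px_corank1 c0 rmorph0 !mul0r.
Qed.

(** An operator is the sum of its restrictions along [one_split]: the monomials of
    degree less than [N] have arbitrary images, and the rest is a multiplication. *)
Lemma act_realize (A : {linear V -> V}) N r :
  (forall p, A (p * 'X^N) = p * r) -> exists a, act a =1 A.
Proof.
move=> Ar; exists (\sum_(i < N) px (A 'X^i) * q * y ^+ i + px r * y ^+ N) => p.
rewrite -{2}(poly_take_drop N p) linearD /= Ar actD actM act_px act_shiftLX.
congr (_ + _); rewrite act_sum /take_poly poly_def linear_sum /=.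
apply: eq_bigr => i _; rewrite !actM act_px act_corank1 act_shiftLX coefE add0n.
by rewrite mul_polyC linearZ.
Qed.

(** * Index *)

Lemma shiftRX_scale_inj k l (c d : F) :
  c != 0 -> c *: x ^+ k = d *: x ^+ l -> c = d /\ k = l.
Proof.
move=> c0 /(congr1 (act^~ 1)); rewrite !actZ !act_shiftRX !mul1r => E.
have kl : k = l.
  have d0 : d != 0.
    apply: contraNneq c0 => d0; move: E; rewrite d0 scale0r => /eqP.
    by rewrite scaler_eq0 -size_poly_eq0 size_polyXn orbF.
  by have := congr1 (fun p : V => size p) E; rewrite !size_scale // !size_polyXn => -[].
split=> //; have := congr1 (fun p : V => p`_k) E.
by rewrite /= !coefE kl eqxx !mulr1.
Qed.

(** The tails of [a] and [b] multiply to a power of the variable, whose only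
    divisors are monomials. *)
Lemma left_inverse_tail a b : b * a = 1 ->
  exists N k (c : F), c != 0 /\ a * x ^+ N = c *: x ^+ k.
Proof.
move=> ba1; have [N [p ap]] := tail_poly a; have [M [r br]] := tail_poly b.
have pr : r * p = 'X^(M + N).
  apply: px_inj; rewrite rmorphM /= -br -mulrA -pxXn px_comm !pxXn -ap.
  by rewrite -mulrA -exprD mulrA ba1 mul1r addnC.
have : p %| ('X - 0%:P) ^+ (M + N) by rewrite polyC0 subr0 -pr dvdp_mull.
case/dvdp_exp_XsubCP => k _; rewrite polyC0 subr0 => /eqpP[[c d] /= /andP[c0 d0] E].
exists N, k, (c^-1 * d); split; first by rewrite mulf_neq0 ?invr_eq0.
have -> : a * x ^+ N = px ((c^-1 * d) *: 'X^k).
  by rewrite ap -scalerA -E scalerA mulVf // scale1r.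
by rewrite linearZ /= mulr_algl pxXn.
Qed.

(** Above a bounded range of degrees [a] shifts degrees by [k - N]; [M] bounds the
    images of the finitely many monomials below [N]. *)
Lemma size_act_tail a N k (c : F) : a * x ^+ N = c *: x ^+ k ->
  exists M, forall p, (size (act a p) <= maxn M (size p + k - N))%N.
Proof.
move=> aN; exists (\max_(i < N) size (act a 'X^i)) => p.
rewrite -{1}(poly_take_drop N p) linearD /=.
apply: leq_trans (size_polyD _ _) _; rewrite geq_max leq_max; apply/andP; split.
  apply/orP; left; rewrite /take_poly poly_def linear_sum /=.
  apply: leq_trans (size_sum _ _ _) _; apply/bigmax_leqP => i _.
  rewrite linearZ /=; apply: leq_trans (size_scale_leq _ _) _.
  exact: (leq_bigmax i).
rewrite -act_shiftRX -actM aN actZ act_shiftRX.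
apply: leq_trans (size_scale_leq _ _) _.
have [/drop_poly_eq0 ->|Np] := leqP (size p) N; first by rewrite mul0r size_poly0.
rewrite leq_max; apply/orP; right.
apply: leq_trans (size_polyMleq _ _) _.
rewrite size_polyXn size_drop_poly; move: Np; move: (size p) => s; lia.
Qed.

(** The invariance of dimension, in the form in which it is used to bound the index. *)
Lemma injective_size_mono (A : {linear V -> V}) R R' : injective A ->
  (forall p : V, (size p <= R)%N -> (size (A p) <= R')%N) -> (R <= R')%N.
Proof.
move=> Ainj AR; pose f := poly_rV \o A \o rVpoly : 'rV[F]_R -> 'rV[F]_R'.
pose g := lin1_mx f.
have : row_free g.
  rewrite -kermx_eq0; apply/eqP/row_matrixP => i; rewrite row0.
  set v := row i _; have : v *m g = 0.
    by rewrite /v -row_mul mulmx_ker row0.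
  rewrite mul_rV_lin1 /f /= => /(congr1 rVpoly); rewrite linear0 poly_rV_K; last first.
    by apply: AR; apply: size_poly.
  move=> /esym; rewrite -[0](linear0 A) => /Ainj /(congr1 (@poly_rV F R)).
  by rewrite rVpolyK linear0 => <-.
by rewrite -row_leq_rank => /leq_trans; apply; apply: rank_leq_col.
Qed.

Lemma injective_tail a N k (c : F) :
  injective (act a) -> a * x ^+ N = c *: x ^+ k -> (N <= k)%N.
Proof.
move=> ainj /size_act_tail[M aM].
have := @injective_size_mono (act a) (M + N)%N (M + k)%N ainj.
rewrite leq_add2l; apply=> p pR; apply: leq_trans (aM p) _.
by rewrite geq_max leq_addr /=; move: pR; move: (size p) => s; lia.
Qed.

(** Both [u] and [v] are injective, so neither lowers degrees, and their shifts add
    up to zero. *)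
Lemma unit_tail u v : u * v = 1 -> v * u = 1 ->
  exists N (c : F), c != 0 /\ u * x ^+ N = c *: x ^+ N.
Proof.
have inj a b : b * a = 1 -> injective (act a).
  by move=> ba1; apply: (can_inj (g := act b)) => p; rewrite -actM ba1 act1.
move=> uv vu; have [N [k [c [c0 uN]]]] := left_inverse_tail vu.
have [M [l [d [d0 vM]]]] := left_inverse_tail uv.
exists N, c; split=> //; rewrite uN; congr (_ *: _ ^+ _).
have Nk := injective_tail (inj _ _ vu) uN; have Ml := injective_tail (inj _ _ uv) vM.
have : 1 *: x ^+ (N + M) = (c * d) *: x ^+ (k + l).
  rewrite scale1r -[_ ^+ (N + M)]mul1r -vu exprD -!mulrA [u * _]mulrA uN.
  rewrite -scalerAl -exprD addnC exprD -scalerAr mulrA vM.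
  by rewrite -scalerAl -exprD scalerA addnC.
move/(shiftRX_scale_inj (oner_neq0 _)) => [_]; lia.
Qed.

(** * Automorphisms are spatial *)

Lemma gauge_shiftR a : gauge a x = val a *: x.
Proof. by rewrite raddfD /= !gauge_lcls /= !lclsZ scalerDr. Qed.

Lemma act_lead (p : V) : act (q * y ^+ (size p).-1) p = (lead_coef p)%:P.
Proof. by rewrite actM act_shiftLX act_corank1 coefE add0n. Qed.

Lemma corank1_neq0 : q != 0.
Proof.
apply/eqP => /(congr1 (act^~ 1)); rewrite act_corank1 act0 coefE /= => /eqP.
by rewrite oner_eq0.
Qed.

Definition intertwines (f : L -> L) (T : V -> V) :=
  forall b p, T (act b p) = act (f b) (T p).

(** [f] maps [L * q] to [L * f q], which is again isomorphic to [V] as a left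
    module: sending [px p * q] to [f (px p)] applied to a vector [w] fixed by [f q]
    gives [T].  It is bijective because [V] is simple: some [q * y ^+ n] carries
    any nonzero vector to a nonzero constant, and constants generate [V]. *)
Lemma automorphism_spatial (f g : {lrmorphism L -> L}) :
  cancel f g -> cancel g f ->
  exists T T' : {linear V -> V},
    [/\ cancel T T', cancel T' T, intertwines f T & intertwines g T'].
Proof.
move=> fK gK.
have [v fqv] : exists v, act (f q) v != 0.
  have [[v fqv]|nv] := pselect (exists v, act (f q) v != 0); first by exists v.
  case/eqP: corank1_neq0; apply: (can_inj fK); rewrite raddf0.
  apply: act_faithful => v; rewrite act0; apply: contrapT => /eqP fqv.
  by apply: nv; exists v.
set w := act (f q) v in fqv.
pose T p := act (f (px p)) w.
have Tl : linear T by move=> k p r; rewrite /T !linearP /= mulr_algl linearP /= actD actZ.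
pose Tm := GRing.isLinear.Build _ _ _ _ T Tl.
pose TL : {linear V -> V} := HB.pack T Tm.
have wq : act (f q) w = w by rewrite /w -actM -rmorphM corank1M.
have TI : intertwines f T.
  move=> b p; rewrite /T -actM -rmorphM -[in LHS]wq -[in RHS]wq -!actM -!rmorphM.
  by rewrite px_corank1.
have TC (k : F) : T k%:P = k *: w.
  by rewrite /T horner_algC linearZ /= rmorph1 actZ act1.
have Tinj p : T p = 0 -> p = 0.
  move=> Tp0; apply/eqP; rewrite -lead_coef_eq0.
  have := TI (q * y ^+ (size p).-1) p; rewrite Tp0 linear0 act_lead TC => /eqP.
  by rewrite scaler_eq0 (negPf fqv) orbF.
have Tsur r : exists p, T p = r.
  exists (act (g (px ((lead_coef w)^-1 *: r) * (q * y ^+ (size w).-1))) 1).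
  rewrite TI gK (_ : T 1 = w); last by rewrite -polyC1 TC scale1r.
  rewrite actM act_lead act_px mul_polyC scalerA mulfV ?scale1r //.
  by rewrite lead_coef_eq0.
pose T' r := projT1 (cid (Tsur r)).
have T'K : cancel T' T by move=> r; rewrite /T'; case: cid.
have TK : cancel T T'.
  move=> p; apply/eqP; rewrite -subr_eq0; apply/eqP/Tinj.
  by rewrite -[T _]/(TL _) raddfB /= T'K subrr.
have T'l : linear T' by exact: (can2_linear (f := TL)) TK T'K.
pose T'm := GRing.isLinear.Build _ _ _ _ T' T'l.
pose TL' : {linear V -> V} := HB.pack T' T'm.
exists TL, TL'; split=> // b p; apply: (can_inj TK).
by rewrite /= TI T'K gK T'K.
Qed.

Section ShiftImage.
Variables (f g : {lrmorphism L -> L}).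
Hypotheses (fK : cancel f g) (gK : cancel g f).

Lemma tail_iter N d (c : F) j :
  f x * x ^+ N = c *: x ^+ (N + d) -> 
  f x ^+ j * x ^+ N = c ^+ j *: x ^+ (N + j * d).
Proof.
move=> fN; elim: j => [|j IH]; first by rewrite !expr0 mul1r scale1r addn0.
rewrite exprSr -mulrA fN -scalerAr exprD mulrA IH -scalerAl scalerA -exprD -exprS.
by rewrite mulSn addnA addnAC.
Qed.

(** Apply [f] to the equation for [g x] and compare the tails. *)
Lemma tail_comp N d (c : F) M d' (c' : F) : c != 0 ->
  f x * x ^+ N = c *: x ^+ (N + d) -> g x * x ^+ M = c' *: x ^+ (M + d') ->
  (c ^+ M = c' * c ^+ (M + d')) /\ (d' * d = 1)%N.
Proof.
move=> c0 fN /(congr1 f); rewrite rmorphM /= gK linearZ /= !rmorphXn /=.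
move=> /(congr1 ( *%R^~ (x ^+ N))).
rewrite -mulrA -scalerAl !(tail_iter _ fN) -scalerAr -exprS scalerA.
move=> /(shiftRX_scale_inj (expf_neq0 _ c0)) [-> E]; split=> //.
by move: E; rewrite mulnDl; nia.
Qed.

(** If [f x] lowered degrees then [T 1, T 'X, ...] would have bounded
    degree, contradicting the surjectivity of [T]. *)
Lemma shift_image_up : exists N d (c : F),
  c != 0 /\ f x * x ^+ N = c *: x ^+ (N + d).
Proof.
have fyx : f y * f x = 1 by rewrite -rmorphM shiftLR rmorph1.
have [N [k [c [c0 fN]]]] := left_inverse_tail fyx.
have [T [T' [TK T'K TI _]]] := automorphism_spatial fK gK.
suff Nk : (N <= k)%N by exists N, (k - N)%N, c; rewrite subnKC.
rewrite leqNgt; apply/negP => kN; have [M fM] := size_act_tail fN.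
pose B := maxn M (size (T 1)).
have TB p : (size (T p) <= B)%N.
  elim/poly_ind: p => [|p k' IH]; first by rewrite linear0 size_poly0.
  rewrite linearD /= (leq_trans (size_polyD _ _)) // geq_max; apply/andP; split.
    rewrite -act_shiftR TI (leq_trans (fM _)) // geq_max leq_maxl /=.
    move: IH kN; move: (size _) => s; lia.
  rewrite -alg_polyC linearZ /= (leq_trans (size_scale_leq _ _)) //.
  by rewrite leq_maxr.
by have := TB (T' 'X^B); rewrite T'K size_polyXn ltnn.
Qed.

End ShiftImage.

(** The shifts of [f] and of its inverse are natural numbers with product [1]. *)
Lemma automorphism_shift (f g : {lrmorphism L -> L}) :
  cancel f g -> cancel g f ->
  exists N (c : F), c != 0 /\ f x * x ^+ N = c *: x ^+ N.+1.
Proof.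
move=> fK gK; have [N [d [c [c0 fN]]]] := shift_image_up fK gK.
have [M [d' [c' [c'0 gM]]]] := shift_image_up gK fK.
have [_ /eqP] := tail_comp gK c0 fN gM.
rewrite muln_eq1 => /andP[_ /eqP d1]; exists N, c; split=> //.
by rewrite fN d1 addn1.
Qed.

Lemma tail_iterV (f : {lrmorphism L -> L}) N :
  f x * x ^+ N = x ^+ N.+1 -> forall j, f y ^+ j * x ^+ (N + j) = x ^+ N.
Proof.
move=> fN j; have fj : f x ^+ j * x ^+ N = x ^+ (N + j).
  have := @tail_iter f N 1 1 j; rewrite !addn1 !scale1r expr1n muln1 scale1r.
  exact.
rewrite -fj mulrA -!rmorphXn -rmorphM.
have -> : y ^+ j * x ^+ j = 1.
  elim: j {fj} => [|j IH]; first by rewrite !expr0 mulr1.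
  by rewrite exprSr exprS mulrA -(mulrA _ y) shiftLR mulr1.
by rewrite rmorph1 mul1r.
Qed.

(** The element [x ^+ N * y ^+ N] projects to the multiples of ['X^N], and its image
    under the inverse automorphism fixes all multiples of ['X^(M + N)].  Hence [T]
    maps the latter into the former, where [f (px p)] acts like [px p]; so [T] is a
    multiplication there. *)
Lemma tame_intertwiner (f g : {lrmorphism L -> L}) (T : {linear V -> V}) N M :
  cancel g f -> intertwines f T ->
  f x * x ^+ N = x ^+ N.+1 -> g x * x ^+ M = x ^+ M.+1 ->
  exists a, act a =1 T.
Proof.
move=> gK TI fN gM; apply: (@act_realize T (M + N) (T 'X^(M + N))) => p.
have gK' : g (x ^+ N * y ^+ N) * x ^+ (M + N) = x ^+ (M + N).
  rewrite rmorphM !rmorphXn /= -mulrA (tail_iterV gM).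
  have := @tail_iter g M 1 1 N; rewrite !addn1 !scale1r expr1n muln1 scale1r.
  exact.
have TX r : exists s, T (r * 'X^(M + N)) = act (x ^+ N) s.
  exists (act (y ^+ N) (T (r * 'X^(M + N)))).
  by rewrite -actM -[in LHS]act_shiftRX -gK' [act (_ * x ^+ _) _]actM TI /= gK act_shiftRX.
have fpx r : f (px r) * x ^+ N = px r * x ^+ N.
  elim/poly_ind: r => [|r c IH]; first by rewrite !rmorph0.
  rewrite !rmorphD !rmorphM /= horner_algX horner_algC linearZ /= rmorph1.
  rewrite !mulrDl -!mulrA fN; congr (_ + _).
  by rewrite exprSr (mulrA (f _)) IH -mulrA -exprSr exprS.
have [s Ts] := TX 1; rewrite mul1r in Ts.
rewrite [p * 'X^_]mulrC -[_ * p]act_px TI Ts -actM fpx -pxXn px_comm actM.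
by rewrite !act_px mulrAC mulrC.
Qed.

(** * Decomposition of automorphisms *)

(** Such a [u] fixes all multiples of ['X^N]: it is the sum of the identity and of a
    matrix with finitely many nonzero columns.  These columns are polynomials, so
    the matrix is finite. *)
Definition finitary (u : L) := exists N, u * x ^+ N = x ^+ N.

Lemma finitaryM u v : finitary u -> finitary v -> finitary (u * v).
Proof.
move=> [N uN] [M vM]; exists (M + N)%N.
by rewrite exprD mulrA -(mulrA u) vM -mulrA -exprD addnC exprD mulrA uN.
Qed.

Lemma finitary_gauge a u : finitary u -> finitary (gauge a u).
Proof.
move=> [N uN]; exists N; have := congr1 (gauge a) uN.
rewrite rmorphM /= rmorphXn /= gauge_shiftR exprZn -scalerAr.
by move/(scalerI (expf_neq0 _ (valP a))).
Qed.

Lemma finitary_inv u v : v * u = 1 -> finitary u -> finitary v.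
Proof. by move=> vu [N uN]; exists N; rewrite -[in LHS]uN mulrA vu mul1r. Qed.

(** Commuting with [x] transports the identity action far from the origin back to
    the origin. *)
Lemma finitary_central u : finitary u -> u * x = x * u -> u = 1.
Proof.
move=> [N uN] ux; apply: act_faithful => p; rewrite act1.
have : act (u * x ^+ N) p = act (x ^+ N * u) p.
  by rewrite (commrX N (ux : GRing.comm u x)).
rewrite uN actM !act_shiftRX => E; apply: esym; move: E.
by apply: mulIf; rewrite expf_neq0 ?polyX_eq0.
Qed.

(** Twisting by the gauge automorphism makes [f1 x] and [x] equal far from the
    origin, and by [tail_comp] the same then holds for the inverse of [f1]; so
    [tame_intertwiner] applies both to [T] and to its inverse. *)
Lemma automorphism_decomposition (f : alg_aut L) :
  exists (a : Fstar F) (u v : L) (uv : u * v = 1) (vu : v * u = 1),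
    finitary u /\ f = (conj_aut uv vu * gauge_aut Gamma1 a)%g.
Proof.
have [g [fK gK]] : exists g : alg_aut L, cancel f g /\ cancel g f.
  by exists (f^-1)%g; split; [apply: alg_autVK|apply: alg_autKV].
have [N [c [c0 fN]]] := automorphism_shift fK gK.
pose a : Fstar F := exist _ c c0.
pose f1 : {lrmorphism L -> L} := f \o gauge a^-1%g.
pose g1 : {lrmorphism L -> L} := gauge a \o g.
have f1K : cancel f1 g1 by move=> s; rewrite /f1 /g1 /= fK gaugeKV.
have g1K : cancel g1 f1 by move=> s; rewrite /f1 /g1 /= gaugeK gK.
have f1N : f1 x * x ^+ N = x ^+ N.+1.
  rewrite /f1 /= gauge_shiftR linearZ /= -scalerAl fN scalerA mulVf //.
  by rewrite scale1r.
have [M [d [d0 g1M]]] := automorphism_shift g1K f1K.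
have {d0}d1 : d = 1.
  have := @tail_comp f1 g1 g1K N 1 1 M 1 d (oner_neq0 _).
  rewrite !addn1 scale1r => /(_ f1N g1M) [+ _].
  by rewrite !expr1n mulr1.
rewrite d1 scale1r in g1M.
have [T [T' [TK T'K TI T'I]]] := automorphism_spatial f1K g1K.
have [u uT] := tame_intertwiner g1K TI f1N g1M.
have [v vT] := tame_intertwiner f1K T'I g1M f1N.
have uv : u * v = 1.
  by apply: act_faithful => p; rewrite actM uT vT T'K act1.
have vu : v * u = 1.
  by apply: act_faithful => p; rewrite actM uT vT TK act1.
have f1E s : f1 s = u * s * v.
  have -> : u * s = f1 s * u by apply: act_faithful => p; rewrite !actM !uT TI.
  by rewrite -mulrA uv mulr1.
have [K [b [b0 uK]]] := unit_tail uv vu.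
have uv' : (b^-1 *: u) * (b *: v) = 1.
  by rewrite -scalerAl -scalerAr scalerA mulVf // scale1r.
have vu' : (b *: v) * (b^-1 *: u) = 1.
  by rewrite -scalerAl -scalerAr scalerA mulfV // scale1r.
exists a, (b^-1 *: u), (b *: v), uv', vu'; split.
  by exists K; rewrite -scalerAl uK scalerA mulVf // scale1r.
apply: alg_autP => s; rewrite /= /conj_fun.
rewrite -scalerAl -scalerAl -scalerAr scalerA mulVf // scale1r -f1E.
by rewrite /f1 /= gaugeK.
Qed.

(** Conjugation by a finitary element does not scale the tail of [x]. *)
Lemma conj_gauge_trivial u v (uv : u * v = 1) (vu : v * u = 1) a :
  finitary u -> conj_aut uv vu = gauge_aut Gamma1 a -> a = 1%g /\ u = 1.
Proof.
move=> [N uN] E; have ux : u * x = val a *: x * u.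
  have /= := congr1 (fun h : alg_aut L => h x) E.
  by rewrite /conj_fun gauge_shiftR => <-; rewrite -(mulrA _ v u) vu mulr1.
have a1 : val a = 1.
  have : (val a) *: x ^+ N.+1 = 1 *: x ^+ N.+1.
    have := congr1 ( *%R^~ (x ^+ N)) ux.
    rewrite /= -mulrA -exprS -!scalerAl -mulrA uN -exprS => <-.
    by rewrite scale1r exprSr mulrA uN.
  by move/(shiftRX_scale_inj (valP a)) => [].
split; first exact: val_inj.
by apply: finitary_central; [exists N|rewrite ux a1 scale1r].
Qed.

(** * Finitary matrices inside the algebra *)

Definition coef (u : L) i j : F := (act u 'X^j)`_i.

Lemma act_poly_coef u m (p : V) : (size p <= m)%N ->
  act u p = \sum_(j < m) p`_j *: act u 'X^j.
Proof.
move=> pm; rewrite -{1}(take_poly_id pm) /take_poly poly_def linear_sum /=.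
by apply: eq_bigr => j _; rewrite linearZ.
Qed.

Lemma coef_inj u v : coef u =2 coef v -> u = v.
Proof.
move=> uv; apply: act_faithful => p; rewrite !(act_poly_coef _ (leqnn _)).
by apply: eq_bigr => j _; congr (_ *: _); apply/polyP => i; apply: uv.
Qed.

Lemma coef1 i j : coef 1 i j = (i == j)%:R.
Proof. by rewrite /coef act1 coefXn. Qed.

Lemma coefM u v m i j : (size (act v 'X^j) <= m)%N ->
  coef (u * v) i j = \sum_(k < m) coef u i k * coef v k j.
Proof.
move=> vm; rewrite /coef actM (act_poly_coef _ vm) coef_sum.
by apply: eq_bigr => k _; rewrite coefZ mulrC.
Qed.

(** The matrix [A] in the upper left corner, completed by the identity: [x ^+ i * q *
    y ^+ j] is the matrix unit of indices [i] and [j], and [x ^+ n * y ^+ n] is the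
    identity on the multiples of ['X^n]. *)
Definition mxelt n (A : 'M[F]_n) : L :=
  x ^+ n * y ^+ n + \sum_i \sum_j A i j *: (x ^+ i * q * y ^+ j).

Lemma mxelt_tail n (A : 'M[F]_n) : mxelt A * x ^+ n = x ^+ n.
Proof.
apply: act_faithful => p; rewrite actM actD actM !act_shiftRX act_shiftLX.
have -> : drop_poly n (p * 'X^n) = p.
  by apply/polyP => i; rewrite !coefE addnK ltnNge leq_addl.
rewrite act_sum big1 ?addr0 // => i _; rewrite act_sum big1 // => j _.
rewrite actZ !actM act_shiftLX act_corank1 coefE add0n coefMXn ltn_ord.
by rewrite linear0 scaler0.
Qed.

Lemma act_mxelt n (A : 'M[F]_n) (k : 'I_n) :
  act (mxelt A) 'X^k = \sum_i A i k *: 'X^i.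
Proof.
rewrite actD actM act_shiftLX drop_poly_eq0 ?size_polyXn // linear0 add0r.
rewrite act_sum; apply: eq_bigr => i _; rewrite act_sum (bigD1 k) //= big1.
  rewrite addr0 actZ !actM act_shiftLX act_corank1 coefE add0n coefXn eqxx.
  by rewrite act_shiftRX mul1r.
move=> j jk; rewrite actZ !actM act_shiftLX act_corank1 coefE add0n coefXn.
by rewrite (_ : (j == k :> nat) = false) ?linear0 ?scaler0 //; apply/negbTE.
Qed.

Lemma coef_mxelt n (A : 'M[F]_n) (i j : 'I_n) : coef (mxelt A) i j = A i j.
Proof.
rewrite /coef act_mxelt coef_sum (bigD1 i) //= big1 ?addr0.
  by rewrite coefZ coefXn eqxx mulr1.
move=> k ki; rewrite coefZ coefXn eq_sym (_ : (k == i :> nat) = false) ?mulr0 //.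
exact/negbTE.
Qed.

Lemma coef_mxelt_out n (A : 'M[F]_n) i j : (n <= i)%N || (n <= j)%N ->
  coef (mxelt A) i j = (i == j)%:R.
Proof.
have [nj _|jn /=] := leqP n j.
  rewrite /coef -[in 'X^j](subnK nj) exprD -act_shiftRX -actM mxelt_tail.
  by rewrite act_shiftRX -exprD subnK // coefXn.
rewrite orbF => ni; rewrite /coef (act_mxelt A (Ordinal jn)) coef_sum big1.
  by rewrite gtn_eqF // (leq_trans jn).
by move=> k _; rewrite coefZ coefXn gtn_eqF ?mulr0 // (leq_trans (ltn_ord k)).
Qed.

Lemma mxelt_inj n : injective (@mxelt n).
Proof. by move=> A B AB; apply/matrixP => i j; rewrite -!coef_mxelt AB. Qed.

Lemma mxelt1 n : mxelt (1%:M : 'M[F]_n) = 1.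
Proof.
apply: coef_inj => i j; rewrite coef1.
have [/coef_mxelt_out -> //|] := boolP ((n <= i)%N || (n <= j)%N).
rewrite negb_or -!ltnNge => /andP[i_n j_n].
by rewrite (coef_mxelt _ (Ordinal i_n) (Ordinal j_n)) mxE.
Qed.

Lemma mxeltM n (A B : 'M[F]_n) : mxelt (A *m B) = mxelt A * mxelt B.
Proof.
apply: coef_inj => i j.
have [nij|] := boolP ((n <= i)%N || (n <= j)%N).
  rewrite coef_mxelt_out //; case: (leqP n j) nij => [nj _|jn /=].
    rewrite /coef -[in RHS](subnK nj) exprD -act_shiftRX -actM -mulrA !mxelt_tail.
    by rewrite act_shiftRX -exprD subnK // coefXn.
  rewrite orbF => ni.
  have sB : (size (act (mxelt B) 'X^j) <= n)%N.
    by apply/leq_sizeP => k nk; rewrite [LHS]coef_mxelt_out ?nk // gtn_eqF // (leq_trans jn).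
  rewrite (coefM _ _ sB) big1; first by rewrite gtn_eqF // (leq_trans jn).
  by move=> k _; rewrite coef_mxelt_out ?ni // gtn_eqF ?mul0r // (leq_trans (ltn_ord k)).
rewrite negb_or -!ltnNge => /andP[i_n j_n].
rewrite (coef_mxelt _ (Ordinal i_n) (Ordinal j_n)) mxE (@coefM _ _ n).
  by apply: eq_bigr => k _; rewrite (coef_mxelt A (Ordinal i_n) k) (coef_mxelt B k (Ordinal j_n)).
by apply/leq_sizeP => k nk; rewrite [LHS]coef_mxelt_out ?nk // gtn_eqF // (leq_trans j_n).
Qed.

Lemma star_shiftR : lpa_star x = y.
Proof. by rewrite /shiftR /arr -lclsD lcls_star /= lclsD. Qed.

Lemma star_shiftL : lpa_star y = x.
Proof. by rewrite -star_shiftR lpa_starK. Qed.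

Lemma star_corank1 : lpa_star q = q.
Proof. by rewrite lcls_star. Qed.

HB.instance Definition _ :=
  GRing.isLinear.Build F L L *:%R (@lpa_star F Gamma1) (@lpa_star_linear F Gamma1).

Lemma star1 : lpa_star (1 : L) = 1.
Proof. by rewrite -shiftLR lpa_star_anti star_shiftR star_shiftL. Qed.

Lemma starX (s : L) n : lpa_star (s ^+ n) = lpa_star s ^+ n.
Proof.
elim: n => [|n IH]; first by rewrite !expr0 star1.
by rewrite exprS lpa_star_anti IH -exprSr.
Qed.

Lemma star_mxelt n (A : 'M[F]_n) : lpa_star (mxelt A) = mxelt A^T.
Proof.
rewrite /mxelt linearD /= lpa_star_anti !starX star_shiftR star_shiftL.
congr (_ + _); rewrite linear_sum exchange_big /=.
apply: eq_bigr => i _; rewrite linear_sum; apply: eq_bigr => j _ /=.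
by rewrite mxE linearZ /= !lpa_star_anti !starX star_shiftR star_shiftL star_corank1 mulrA.
Qed.

Definition corner (u : L) n : 'M[F]_n := \matrix_(i, j) coef u i j.

(** The size [n] must exceed both the rank [N] from which [u] is the identity and
    the degrees of the finitely many columns before it. *)
Lemma finitary_corner u : finitary u ->
  exists n0, forall n, (n0 <= n)%N -> u = mxelt (corner u n).
Proof.
move=> [N uN]; exists (N + \max_(j < N) size (act u 'X^j))%N => n n0n.
have ufix j : (N <= j)%N -> act u 'X^j = 'X^j.
  move=> Nj; rewrite -(subnK Nj) exprD -{1}act_shiftRX -actM uN act_shiftRX.
  by rewrite -exprD subnK.
have usize j : (j < n)%N -> (size (act u 'X^j) <= n)%N.
  move=> jn; have [/ufix ->|jN] := leqP N j; first by rewrite size_polyXn.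
  apply: leq_trans n0n; apply: leq_trans (leq_addl _ _).
  exact: (leq_bigmax (Ordinal jN)).
apply: coef_inj => i j.
have [nij|] := boolP ((n <= i)%N || (n <= j)%N).
  rewrite coef_mxelt_out //; case: (leqP n j) nij => [nj _|jn /=].
    by rewrite /coef ufix ?coefXn // (leq_trans (leq_trans (leq_addr _ _) n0n)).
  rewrite orbF => ni; rewrite gtn_eqF ?(leq_trans jn) //.
  by rewrite /coef nth_default // (leq_trans (usize _ jn)).
rewrite negb_or -!ltnNge => /andP[i_n j_n].
by rewrite (coef_mxelt _ (Ordinal i_n) (Ordinal j_n)) mxE.
Qed.

(** * The finitary general linear group *)

Lemma IdMoo_boundW (A : IdMoo F) :
  exists n, forall i j, (n <= i)%N || (n <= j)%N -> A i j = (i == j)%:R.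
Proof. exact: IdMoo_bound. Qed.

Definition IdMoo_elt (A : IdMoo F) : L :=
  mxelt (\matrix_(i < projT1 (cid (IdMoo_boundW A)), j < _) A i j).

Lemma coef_IdMoo A : coef (IdMoo_elt A) =2 A.
Proof.
rewrite /IdMoo_elt; case: cid => n /= An i j.
have [nij|] := boolP ((n <= i)%N || (n <= j)%N).
  by rewrite coef_mxelt_out // An.
rewrite negb_or -!ltnNge => /andP[i_n j_n].
by rewrite (coef_mxelt _ (Ordinal i_n) (Ordinal j_n)) mxE.
Qed.

Lemma finitary_IdMoo A : finitary (IdMoo_elt A).
Proof. by eexists; apply: mxelt_tail. Qed.

Lemma IdMoo_elt_inj : injective IdMoo_elt.
Proof.
by move=> A B AB; apply: IdMoo_inj => i j; rewrite -!coef_IdMoo AB.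
Qed.

Lemma IdMoo_elt1 : IdMoo_elt 1%g = 1.
Proof. by apply: coef_inj => i j; rewrite coef_IdMoo coef1. Qed.

Lemma IdMoo_eltM A B : IdMoo_elt (A * B)%g = IdMoo_elt A * IdMoo_elt B.
Proof.
apply: coef_inj => i j; rewrite coef_IdMoo.
have [n An] := IdMoo_boundW A.
pose m := (maxn n i.+1 + size (act (IdMoo_elt B) 'X^j))%N.
rewrite (@coefM _ _ m) ?leq_addl //.
under eq_bigr do rewrite !coef_IdMoo.
apply: (@imxME F A B i j m) => k mk.
have : (maxn n i.+1 <= k)%N by rewrite (leq_trans _ mk) ?leq_addr.
by rewrite geq_max => /andP[nk ik]; rewrite An ?nk ?orbT // ltn_eqF.
Qed.

Lemma finitary_IdMooP u : finitary u -> exists A, IdMoo_elt A = u.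
Proof.
move=> /finitary_corner[n /(_ n (leqnn _)) un].
have fin : finite_mx (fun i j => coef u i j - imx1 F i j).
  apply/finite_mxP; exists n => i j nij.
  by rewrite un coef_mxelt_out // /imx1 subrr.
by exists (mkIdMoo fin); apply: coef_inj => i j; rewrite coef_IdMoo.
Qed.

Lemma GLoo_mulV (A : GLoo F) :
  IdMoo_elt (munit_val A) * IdMoo_elt (munit_inv A) = 1.
Proof. by rewrite -IdMoo_eltM munit_mulV IdMoo_elt1. Qed.

Lemma GLoo_Vmul (A : GLoo F) :
  IdMoo_elt (munit_inv A) * IdMoo_elt (munit_val A) = 1.
Proof. by rewrite -IdMoo_eltM munit_Vmul IdMoo_elt1. Qed.

Definition GLoo_aut (A : GLoo F) : alg_aut L :=
  conj_aut (GLoo_mulV A) (GLoo_Vmul A).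

Lemma GLoo_autM : {morph GLoo_aut : A B / (A * B)%g}.
Proof.
move=> A B; apply: alg_autP => s; rewrite /= /conj_fun.
by rewrite !IdMoo_eltM !mulrA.
Qed.

Lemma finitary_unit_GLoo u v (uv : u * v = 1) (vu : v * u = 1) :
  finitary u -> exists A, GLoo_aut A = conj_aut uv vu.
Proof.
move=> fu; have [A Au] := finitary_IdMooP fu.
have [B Bv] := finitary_IdMooP (finitary_inv vu fu).
have AB : (A * B)%g = 1%g.
  by apply: IdMoo_elt_inj; rewrite IdMoo_eltM IdMoo_elt1 Au Bv.
have BA : (B * A)%g = 1%g.
  by apply: IdMoo_elt_inj; rewrite IdMoo_eltM IdMoo_elt1 Au Bv.
exists (MUnit AB BA); apply: alg_autP => s.
by rewrite /= /conj_fun /= Au Bv.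
Qed.

Lemma gauge_autM : {morph @gauge_aut F Gamma1 : a b / (a * b)%g}.
Proof. by move=> a b; apply: alg_autP => s; apply: gaugeM. Qed.

End Toeplitz.

(** * Recognition of semidirect products *)

Section InternalSemidirectProduct.
Local Open Scope group_scope.
Variables (G N H : groupType) (i : N -> G) (j : H -> G).
Hypotheses (iM : {morph i : m n / m * n}) (jM : {morph j : g h / g * h}).
Hypothesis ij_trivial : forall n h, i n = j h -> n = 1 /\ h = 1.
Hypothesis i_normal : forall h n, exists m, i m = j h * i n * (j h)^-1.
Hypothesis ij_full : forall g, exists n h, g = i n * j h.

Let i1 : i 1 = 1. Proof. by apply: (mulgI (i 1)); rewrite -iM !mulg1. Qed.
Let j1 : j 1 = 1. Proof. by apply: (mulgI (j 1)); rewrite -jM !mulg1. Qed.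

Let iV n : i n^-1 = (i n)^-1.
Proof. by apply: (mulIg (i n)); rewrite -iM !mulVg i1. Qed.
Let jV h : j h^-1 = (j h)^-1.
Proof. by apply: (mulIg (j h)); rewrite -jM !mulVg j1. Qed.

Let i_inj : injective i.
Proof.
move=> m n mn; have [+ _] : m * n^-1 = 1 /\ 1 = 1 :> H.
  by apply: ij_trivial; rewrite iM iV mn mulgV j1.
by move/(congr1 (fun z => z * n)); rewrite mulgVK mul1g.
Qed.

(** [H] acts on [N] by conjugation in [G], pulled back along [i]. *)
Lemma internal_semidirect :
  exists theta : group_action H N, group_isomorphic G (sdprod theta).
Proof.
pose th h n := projT1 (cid (i_normal h n)).
have thE h n : i (th h n) = j h * i n * (j h)^-1 by rewrite /th; case: cid.
have thM h : {morph th h : m n / m * n}.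
  by move=> m n; apply: i_inj; rewrite iM !thE iM !mulgA mulgVK.
have th1 n : th 1 n = n.
  by apply: i_inj; rewrite thE j1 mul1g invg1 mulg1.
have thMl g h n : th (g * h) n = th g (th h n).
  by apply: i_inj; rewrite !thE jM invgM !mulgA.
pose theta := GroupAction thM th1 thMl; exists theta.
pose f (s : sdprod theta) := i (sd_normal s) * j (sd_compl s).
have fM : {morph f : s t / s * t}.
  move=> [m g] [n h]; by rewrite /f /= iM jM thE !mulgA mulgVK.
have f_inj : injective f.
  move=> [m g] [n h]; rewrite /f /= => E.
  have gh : g = h.
    have [_ ghV] : m^-1 * n = 1 /\ g * h^-1 = 1.
      by apply: ij_trivial; rewrite iM jM iV jV -(mulgK (j h) (i n)) -E !mulgA mulVg mul1g.
    by apply: (mulIg h^-1); rewrite mulgV.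
  by rewrite gh in E *; rewrite (i_inj (mulIg _ _ _ E)).
pose k g := projT1 (cid (ij_full g)).
have kE g : exists h, g = i (k g) * j h by rewrite /k; case: cid.
pose l g := projT1 (cid (kE g)).
have klE g : g = i (k g) * j (l g) by rewrite /l; case: cid.
pose f' g : sdprod theta := SDProd theta (k g) (l g).
have f'K : cancel f' f by move=> g; rewrite /f /= -klE.
have fK : cancel f f' by move=> s; apply: f_inj; rewrite f'K.
exists f'; first by exists f.
by move=> g h; apply: f_inj; rewrite fM !f'K.
Qed.

End InternalSemidirectProduct.

(** * Symmetric bilinear forms over quadratically closed fields *)

Section Orthonormal.
Variable F : fieldType.

Definition mxcongr n (A B : 'M[F]_n) :=
  exists2 P, P \in unitmx & B = P *m A *m P^T.

Lemma mxcongr_trans n (B A C : 'M_n) : mxcongr A B -> mxcongr B C -> mxcongr A C.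
Proof.
move=> [P Pu ->] [Q Qu ->]; exists (Q *m P); first by rewrite unitmx_mul Qu.
by rewrite trmx_mul !mulmxA.
Qed.

Lemma mxcongr_unit n (A B : 'M_n) : mxcongr A B -> A \in unitmx -> B \in unitmx.
Proof. by move=> [P Pu ->] Au; rewrite !unitmx_mul unitmx_tr Pu Au. Qed.

Lemma mxcongr_sym n (A B : 'M_n) : mxcongr A B -> A^T = A -> B^T = B.
Proof. by move=> [P _ ->] As; rewrite !trmx_mul trmxK As mulmxA. Qed.

Definition add1 n (A : 'M[F]_n) : 'M_(1 + n) := block_mx 1%:M 0 0 A.

Lemma add1_unit n (A : 'M_n) : (add1 A \in unitmx) = (A \in unitmx).
Proof. by rewrite !unitmxE det_ublock det1 mul1r. Qed.

Lemma add1_sym n (A : 'M_n) : (add1 A)^T = add1 A -> A^T = A.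
Proof. by rewrite tr_block_mx => /eq_block_mx[]. Qed.

Lemma mxcongr_add1 n (A B : 'M_n) : mxcongr A B -> mxcongr (add1 A) (add1 B).
Proof.
move=> [P Pu ->]; exists (add1 P); first by rewrite add1_unit.
rewrite /add1 tr_block_mx !trmx0 trmx1 !mulmx_block.
by rewrite !(mul0mx, mulmx0, addr0, add0r, mul1mx, mulmx1).
Qed.

Hypothesis sqrtF : forall a : F, exists b, b ^+ 2 = a.

(** One step of Gram-Schmidt, from a basis vector that is not isotropic. *)
Lemma mxcongr_split n (A : 'M[F]_(1 + n)) i : A^T = A -> A i i != 0 ->
  exists B : 'M_n, mxcongr A (add1 B).
Proof.
move=> As Aii.
pose S := perm_mx (tperm 0 i) : 'M[F]_(1 + n).
pose A1 := S *m A *m S^T.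
have A1c : mxcongr A A1 by exists S; rewrite ?unitmx_perm.
have A1s := mxcongr_sym A1c As.
have A100 : A1 0 0 = A i i.
  by rewrite /A1 /S tr_perm_mx -row_permE -col_permE !mxE tpermL.
pose a := A i i; have [c c2] := sqrtF a^-1.
have c0 : c != 0 by rewrite -sqrf_eq0 c2 invr_eq0.
pose r := ursubmx A1; pose D := drsubmx A1.
have A1E : A1 = block_mx a%:M r r^T D.
  rewrite -[LHS]submxK; congr block_mx.
    rewrite [LHS]mx11_scalar /a -A100; congr (_%:M); do 2!rewrite mxE.
    by congr (A1 _ _); apply: val_inj.
  by rewrite /r -[in RHS]A1s -trmx_dlsub trmxK.
exists (D - a^-1 *: (r^T *m r)); apply: mxcongr_trans A1c _.
(* Scale the first vector by [c] and project the others to its complement. *)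
exists (block_mx c%:M 0 (- a^-1 *: r^T) 1%:M).
  by rewrite unitmxE det_lblock det_scalar1 det1 mulr1 unitfE.
rewrite A1E tr_block_mx !mulmx_block !linearZ /= trmxK !tr_scalar_mx trmx0.
rewrite !(mul0mx, mulmx0, addr0, add0r, mul1mx, mulmx1).
have a0 : a != 0 := Aii.
rewrite !mul_scalar_mx -!scalemxAl.
rewrite /add1; congr block_mx.
- by rewrite -scalar_mxM scale_scalar_mx mulrCA -expr2 c2 mulfV.
- by rewrite mul_scalar_mx !scalerA !mulNr mulrAC mulVf // mul1r scaleNr addNr.
- by rewrite [_ *m a%:M]mul_mx_scalar scalerA mulNr mulVf // scaleN1r addNr mul0mx.
rewrite [_ *m a%:M]mul_mx_scalar scalerA mulNr mulVf // scaleN1r addNr mul0mx scaler0.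
by rewrite add0r addrC scaleNr scalerN.
Qed.

(** An alternating form has no vector to start Gram-Schmidt with.  Trading the unit
    vector [e0] added in front for [e0 + f], with [f] the first basis vector of [A],
    gives again a unit vector, whose complement is no longer alternating. *)
Lemma mxcongr_not_alternating n (A : 'M[F]_n.+1) :
  A \in unitmx -> A^T = A -> (forall i, A i i = 0) ->
  exists2 B : 'M_n.+1, mxcongr (add1 A) (add1 B) & exists i, B i i != 0.
Proof.
move=> Au As A0; pose u : 'rV[F]_n.+1 := delta_mx 0 0; pose b := A *m u^T.
have bT : b^T = u *m A by rewrite trmx_mul trmxK As.
have bE : b = A *m u^T by [].
have uAu : u *m b = 0.
  rewrite mulmxA; apply/matrixP => i j; rewrite !ord1 trmx_delta -rowE -colE.
  by rewrite !mxE A0.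
have bTu : b^T *m u^T = 0 by rewrite -trmx_mul uAu trmx0.
(* The form on the new complement has the diagonal entries [- b i ^ 2]. *)
exists (A - b *m b^T); last first.
  have [i bi] : exists i, b i 0 != 0.
    apply/existsP; apply: contraT => /existsPn b0.
    have : u = 0.
      apply: trmx_inj; rewrite trmx0 -[LHS]mul1mx -(mulVmx Au) -mulmxA -/b.
      rewrite (_ : b = 0) ?mulmx0 //; apply/matrixP => i j.
      by rewrite !ord1 [RHS]mxE; apply/eqP; move: (b0 i); rewrite negbK.
    by move/matrixP/(_ 0 0); rewrite !mxE !eqxx => /eqP; rewrite oner_eq0.
  exists i; rewrite mxE A0 add0r 2!mxE big_ord1 [b^T _ _]mxE oppr_eq0.
  by rewrite mulf_neq0.
clearbody b u.
(* The right factor replaces [e0] by [e0 + f], the left one projects the other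
   vectors to the complement of [e0 + f]. *)
exists (block_mx 1%:M 0 (- b) 1%:M *m block_mx 1%:M u 0 1%:M).
  by rewrite unitmx_mul !unitmxE det_lblock det_ublock !det1 mulr1 unitr1.
rewrite trmx_mul !tr_block_mx !trmx0 !trmx1 !mulmxA /add1 !mulmx_block.
rewrite !(mul0mx, mulmx0, addr0, add0r, mul1mx, mulmx1).
rewrite !linearN /=.
have XA : (- b *m u + 1%:M) *m A = A - b *m b^T.
  by rewrite mulmxDl mul1mx !mulNmx -mulmxA -bT addrC.
have XAu : (A - b *m b^T) *m u^T = b.
  by rewrite mulmxBl -mulmxA bTu mulmx0 subr0 -bE.
by rewrite XA XAu -bT bTu addr0 addNr mul0mx oppr0 add0r mul1mx addNr.
Qed.

(** Gram-Schmidt by induction on the dimension: the complement of the first vector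
    can always be chosen not alternating, unless it is zero. *)
Lemma orthonormal_basis n (A : 'M[F]_n) :
  A \in unitmx -> A^T = A -> (exists i, A i i != 0) -> mxcongr A 1%:M.
Proof.
elim: n A => [|n IH] A Au As [i Aii]; first by case: i Aii.
have [B AB] := @mxcongr_split n A i As Aii.
have Bu : B \in unitmx by rewrite -add1_unit (mxcongr_unit AB).
have Bs : B^T = B by apply: add1_sym; apply: mxcongr_sym AB As.
have add11 m : add1 1%:M = 1%:M :> 'M[F]_(1 + m).
  by rewrite /add1 -scalar_mx_block.
rewrite -[1%:M]add11; case: n => [|n] in A i Au As Aii B AB Bu Bs IH *.
  suff -> : (1%:M : 'M[F]_0) = B by [].
  by rewrite [LHS]flatmx0 [RHS]flatmx0.
have [[k Bk]|nB] := pselect (exists k, B k k != 0).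
  by apply: (mxcongr_trans AB); apply/mxcongr_add1/IH => //; exists k.
have B0 k : B k k = 0.
  by apply: contrapT => /eqP Bk; apply: nB; exists k.
have [C BC Cn] := mxcongr_not_alternating Bu Bs B0.
have Cu : C \in unitmx by rewrite -add1_unit (mxcongr_unit BC) ?add1_unit.
have Cs : C^T = C.
  by apply: add1_sym; apply: mxcongr_sym BC _; apply: mxcongr_sym AB As.
by apply: (mxcongr_trans AB); apply: (mxcongr_trans BC); apply/mxcongr_add1/IH.
Qed.

End Orthonormal.

(** * Involutions *)

Section ToeplitzInvolutions.
Variable F : fieldType.
Local Notation L := (lpa F Gamma1).
Local Notation star := (@lpa_star F Gamma1).

Lemma involution1 (A : algType F) (bar : involution A) : bar 1 = 1.
Proof.
by rewrite -[LHS]mulr1 -{2}[1](inv_invol bar) -inv_anti mulr1 inv_invol.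
Qed.

Lemma finitary_star (u : L) : finitary u -> finitary (star u).
Proof.
move=> /finitary_corner[n /(_ n (leqnn n)) ->].
by rewrite star_mxelt; exists n; apply: mxelt_tail.
Qed.

(** Composing with [star] turns an involution into an automorphism. *)
Lemma involution_decomposition (bar : involution L) :
  exists (a : Fstar F) (u v : L),
    [/\ u * v = 1, v * u = 1, finitary u &
        forall s, bar s = u * gauge a (star s) * v].
Proof.
pose f s := bar (star s).
have fl : linear f.
  by move=> k s t; rewrite /f lpa_star_linear inv_linear.
have fm : GRing.monoid_morphism f.
  split=> [|s t]; first by rewrite /f star1 involution1.
  by rewrite /f lpa_star_anti inv_anti.
have fK : cancel f (fun s => star (bar s)).
  by move=> s; rewrite /f inv_invol lpa_starK.
have fK' : cancel (fun s => star (bar s)) f.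
  by move=> s; rewrite /f lpa_starK inv_invol.
pose fA := GRing.isLinear.Build _ _ _ _ f fl.
pose fM := GRing.isMonoidMorphism.Build _ _ f fm.
pose fLR : {lrmorphism L -> L} := HB.pack f fA fM.
have [a [u [v [uv [vu [fu E]]]]]] :=
  automorphism_decomposition (AlgAut (aut_fun := fLR) (Bijective fK fK')).
exists a, u, v; split=> // s.
have := congr1 (fun h : alg_aut L => h (star s)) E.
by rewrite /= /f lpa_starK /conj_fun.
Qed.

(** Applying the involution twice is conjugation by [c = u * star v], so [c] is
    central; being finitary it is [1]. *)
Lemma involution_symmetric (u v : L) : u * v = 1 -> v * u = 1 -> finitary u ->
  (forall s, u * star (u * star s * v) * v = s) -> star u = u.
Proof.
move=> uv vu fu invol; pose c := u * star v.
have suv : star v * star u = 1 by rewrite -lpa_star_anti uv star1.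
have svu : star u * star v = 1 by rewrite -lpa_star_anti vu star1.
have cc s : c * s = s * c.
  rewrite -[in RHS](invol s) !lpa_star_anti lpa_starK /c !mulrA.
  by rewrite -(mulrA _ v u) vu mulr1 -(mulrA _ (star u)) svu mulr1.
have fc : finitary c.
  by apply: finitaryM => //; apply/finitary_star/(finitary_inv vu).
have c1 : c = 1 by apply: finitary_central (cc _).
by rewrite -[LHS]mul1r -c1 /c -mulrA suv mulr1.
Qed.

(** Taking one more row and column than needed makes the matrix of [u] end with a
    diagonal entry [1], so that it is not alternating. *)
Lemma symmetric_square (u v : L) : (forall a : F, exists b, b ^+ 2 = a) ->
  u * v = 1 -> v * u = 1 -> finitary u -> star u = u ->
  exists p r : L, [/\ p * r = 1, r * p = 1 & u = p * star p].
Proof.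
move=> sqrtF uv vu fu su.
have [m um] := finitary_corner fu.
have [m' vm] := finitary_corner (finitary_inv vu fu).
pose n := (m + m')%N; pose A := corner u n.+1.
have uA : u = mxelt A by apply: um; rewrite ltnW // ltnS leq_addr.
have As : A^T = A by apply: mxelt_inj; rewrite -star_mxelt -uA su.
have Au : A \in unitmx.
  have /mulmx1_unit[] // : A *m corner v n.+1 = 1%:M.
  apply: mxelt_inj; rewrite mxeltM mxelt1 -uA -vm //.
  by rewrite ltnW // ltnS leq_addl.
have An : exists i, A i i != 0.
  exists ord_max; rewrite mxE (um n) ?leq_addr //.
  by rewrite coef_mxelt_out ?leqnn // eqxx oner_eq0.
have [P Pu PA] := orthonormal_basis sqrtF Au As An.
exists (mxelt (invmx P)), (mxelt P); split; rewrite -?mxeltM ?mulVmx ?mulmxV ?mxelt1 //.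
rewrite star_mxelt -mxeltM uA; congr mxelt.
rewrite trmx_inv -[invmx P]mulmx1 PA !mulmxA mulVmx // mul1mx mulmxK //.
by rewrite unitmx_tr.
Qed.

(** A square root [b] of the gauge parameter removes the gauge part, because [star]
    exchanges [gauge b] and [gauge b^-1]. *)
Lemma involution_standard : (forall a : F, exists b, b ^+ 2 = a) ->
  forall bar : involution L,
    involutive_isomorphic bar (std_involution F Gamma1).
Proof.
move=> sqrtF bar; have [a [u [v [uv vu fu barE]]]] := involution_decomposition bar.
have [b0 b2] := sqrtF (val a).
have b_neq0 : b0 != 0 by rewrite -sqrf_eq0 b2 (valP a).
pose b : Fstar F := exist _ b0 b_neq0.
have ab : a = (b * b)%g by apply: val_inj; rewrite /= -b2 expr2.
pose u1 := gauge b^-1%g u; pose v1 := gauge b^-1%g v.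
have uv1 : u1 * v1 = 1 by rewrite -rmorphM uv rmorph1.
have vu1 : v1 * u1 = 1 by rewrite -rmorphM vu rmorph1.
have fu1 : finitary u1 by apply: finitary_gauge.
have bar1E s : gauge b^-1%g (bar (gauge b s)) = u1 * star s * v1.
  rewrite barE star_gauge !rmorphM /= -!gaugeM ab.
  by rewrite !mulgA mulVg mul1g mulgV gauge1.
have su1 : star u1 = u1.
  apply: (involution_symmetric uv1 vu1 fu1) => s.
  by rewrite -!bar1E gaugeKV inv_invol gaugeK.
have [p [r [pr rp u1E]]] := symmetric_square sqrtF uv1 vu1 fu1 su1.
have spr : star r * star p = 1 by rewrite -lpa_star_anti pr star1.
have srp : star p * star r = 1 by rewrite -lpa_star_anti rp star1.
have u1V : u1 * (star r * r) = 1.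
  by rewrite u1E -mulrA (mulrA (star p)) srp mul1r.
have v1E : v1 = star r * r by rewrite -[LHS]mulr1 -u1V mulrA vu1 mul1r.
pose psi : alg_aut L := (conj_aut rp pr * gauge_aut Gamma1 b^-1)%g.
exists psi; first exact: aut_bij.
move=> s; rewrite /= /conj_fun -{1}[s](gaugeKV b) bar1E u1E v1E !lpa_star_anti.
rewrite !mulrA rp mul1r -[RHS]mulrA -!mulrA rp mulr1.
by rewrite !mulrA.
Qed.

End ToeplitzInvolutions.

Theorem theorem3 (F : fieldType) :
  (exists theta : group_action (Fstar F) (GLoo F),
     group_isomorphic (alg_aut (lpa F Gamma1)) (sdprod theta))
  /\
  ((forall a : F, exists b : F, b ^+ 2 = a) ->
   forall bar : involution (lpa F Gamma1),
     involutive_isomorphic bar (std_involution F Gamma1)).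
Proof.
split; last exact: involution_standard.
apply: (internal_semidirect (@GLoo_autM F) (@gauge_autM F)).
- move=> A a E; have [-> A1] := conj_gauge_trivial (finitary_IdMoo _) E.
  by split=> //; apply/munitP/IdMoo_elt_inj; rewrite IdMoo_elt1.
- move=> a A.
  have fA := finitary_gauge a (finitary_IdMoo (munit_val A)).
  have uv : gauge a (IdMoo_elt (munit_val A)) * gauge a (IdMoo_elt (munit_inv A)) = 1.
    by rewrite -rmorphM GLoo_mulV rmorph1.
  have vu : gauge a (IdMoo_elt (munit_inv A)) * gauge a (IdMoo_elt (munit_val A)) = 1.
    by rewrite -rmorphM GLoo_Vmul rmorph1.
  have [B BE] := finitary_unit_GLoo uv vu fA; exists B; rewrite BE.
  apply: (mulIg (gauge_aut Gamma1 a)); rewrite mulgVK.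
  by apply: alg_autP => s; rewrite /= /conj_fun !rmorphM.
- move=> f; have [a [u [v [uv [vu [fu ->]]]]]] := automorphism_decomposition f.
  by have [A <-] := finitary_unit_GLoo uv vu fu; exists A, a.
Qed.
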